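(* Let $F(x,y,q;1)=\sum_{\nu\in\mathcal{CP}}x^{v(\nu)}y^{h(\nu)}q^{int(\nu)}$. Then $\frac{\partial}{\partial q}F(x,y,q;1)\big|_{q=1}$ equals \begin{align*} &\frac{8x^3y^2\left(4x(x^2+6x-1)+4x(5x+11)(y-x-1)+(6x^2+29x+17)(y-x-1)^2\right)}{((1+x-y)^2-4x)^4}\\ &+\frac{x^2y^2(y-x-1)^3\left(40x(2x+1)+2(x^2+11x-8)(y-x-1)+(y-x-1)^2(y+x-1)\right)}{((1+x-y)^2-4x)^4}\\ &+\frac{4x^2y^2\left(4-3(x+y)-(x-y)^2\right)}{\sqrt{(1+x-y)^2-4x}^{\,5}}. \end{align*}
   Context: A cell is a unit square in the plane whose center is an integer point and whose sides are parallel to the axes. A polyomino is a finite set of cells which is connected under edge-adjacency; polyominoes are considered up to translation. A polyomino is convex if each of its columns and each of its rows is a single contiguous block of cells; $\mathcal{CP}$ is the set of nonempty convex polyominoes up to translation. $v(\nu)$ is the number of columns, $h(\nu)$ the number of rows of $\nu$. A vertex of $\nu$ (corner of a cell of $\nu$) is interior if it is a corner of exactly four cells of $\nu$; $int(\nu)$ is the number of interior vertices of $\nu$. *)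

(* Defs.v *)
From mathcomp Require Import all_boot.
Set Implicit Arguments. Unset Strict Implicit. Unset Printing Implicit Defensive.

(* A cell is identified with its (integer) position (column, row).
   Convex polyominoes up to translation with v columns and h rows are
   in bijection with their unique translate whose bounding box is
   exactly [0,v) x [0,h); such a translate is a set of cells
   S : {set 'I_v * 'I_h} meeting every column and every row. *)

Section Polyo.
Variables v h : nat.
Implicit Type S : {set 'I_v * 'I_h}.

Definition cellin S (a b : nat) : bool :=
  [exists c in S, (nat_of_ord c.1 == a) && (nat_of_ord c.2 == b)].

Definition adjc S : rel ('I_v * 'I_h) := fun c d =>
  [&& c \in S, d \in S &
      ((c.1 == d.1) && ((c.2.+1 == d.2 :> nat) || (d.2.+1 == c.2 :> nat)))
   || ((c.2 == d.2) && ((c.1.+1 == d.1 :> nat) || (d.1.+1 == c.1 :> nat)))].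

Definition connectedS S : bool :=
  [forall c in S, forall d in S, connect (adjc S) c d].

Definition rows_convex S : bool :=
  [forall j : 'I_h, forall a : 'I_v, forall b : 'I_v, forall c : 'I_v,
     [&& (a, j) \in S, (c, j) \in S & (a <= b <= c)%N] ==> ((b, j) \in S)].
Definition cols_convex S : bool :=
  [forall i : 'I_v, forall a : 'I_h, forall b : 'I_h, forall c : 'I_h,
     [&& (i, a) \in S, (i, c) \in S & (a <= b <= c)%N] ==> ((i, b) \in S)].

Definition full_box S : bool :=
  [forall i : 'I_v, exists j : 'I_h, (i, j) \in S] &&
  [forall j : 'I_h, exists i : 'I_v, (i, j) \in S].

Definition is_convex_polyomino S : bool :=
  [&& S != set0, connectedS S, rows_convex S, cols_convex S & full_box S].

(* interior vertices: lattice point (a, b) (the common corner of the cells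
   (a-1,b-1), (a,b-1), (a-1,b), (a,b)) which is a corner of four cells of S;
   it suffices to range over a in [1,v), b in [1,h). *)
Definition int_vertices S : nat :=
  #|[set p : 'I_v * 'I_h | [&& 0 < p.1, 0 < p.2,
        cellin S p.1.-1 p.2.-1, cellin S p.1 p.2.-1,
        cellin S p.1.-1 p.2 & cellin S p.1 p.2]%N]|.

Definition int_sum : nat :=
  (\sum_(S : {set 'I_v * 'I_h} | is_convex_polyomino S) int_vertices S)%N.
End Polyo.

(* Main.v *)
(* Read the columns of a convex polyomino from left to right.  Given a column of height k, only k and the
   numbers d, u of rows below and above it that are still to be reached matter for what may follow: a side
   with rows left to reach can only move outwards, and from the moment it has none left it can only move
   inwards.  So the generating functions of the possible continuations satisfy a linear system in k.  Letting
   them count "e + number of interior vertices", where e is the number of vertices already seen, puts the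
   derivative at q = 1 into the same system, since two consecutive columns sharing m + 1 rows add m to e.
   Decomposed into unit steps, each costing one factor x, one factor y or nothing, the system is a set of
   local recurrences in k.  With x = p (1 - w), y = w (1 - p), so that sqrt D = 1 - p - w, it is solved by
   combinations of k^i (1 - sqrt x)^(-k), k^i (1 + sqrt x)^(-k) and k^i (1 - p)^(-k), i <= 2.  The difference
   between this explicit solution and the partial sums by total degree solves the homogeneous system, which
   halves it at each degree when x and y are small; so the series converge to the explicit solution. *)
Require Import Defs.
From mathcomp Require Import all_boot zify.
Set Implicit Arguments. Unset Strict Implicit. Unset Printing Implicit Defensive.

(** * Sequences of intervals: row convexity and unimodal boundaries *)

Section Columns.
Implicit Types (lo hi : nat -> nat).

(** Discrete intermediate value argument: if [r] lies below column [p], then [r < lo p <= hi p.+1],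
    so the hypothesis on [hi p] passes to the next column; at the latest the walk stops at [q]. *)
Lemma row_crossing_up lo hi p q r : p <= q ->
  (forall i, p <= i < q -> lo i <= hi i.+1) -> r <= hi p -> lo q <= r ->
  exists2 i, p <= i <= q & lo i <= r <= hi i.
Proof.
move=> /subnK <-; move: (q - p) => n {q}; elim: n p => [|n IHn] p ov hp hq.
  by exists p; [lia | rewrite hq hp].
case: (leqP (lo p) r) => [lop|lop]; first by exists p; [lia | rewrite lop hp].
have ovp : lo p <= hi p.+1 by apply: ov; lia.
have [|||i ilt ir] := IHn p.+1; last by exists i => //; lia.
- by move=> i ilt; apply: ov; lia.
- by lia.
- by rewrite addnS -addSn.
Qed.

Lemma row_crossing_down lo hi p q r : p <= q ->
  (forall i, p <= i < q -> lo i.+1 <= hi i) -> lo p <= r -> r <= hi q ->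
  exists2 i, p <= i <= q & lo i <= r <= hi i.
Proof.
move=> /subnK <-; move: (q - p) => n {q}; elim: n p => [|n IHn] p ov hp hq.
  by exists p; [lia | rewrite hq hp].
case: (leqP r (hi p)) => [hip|hip]; first by exists p; [lia | rewrite hp hip].
have ovp : lo p.+1 <= hi p by apply: ov; lia.
have [|||i ilt ir] := IHn p.+1; last by exists i => //; lia.
- by move=> i ilt; apply: ov; lia.
- by lia.
- by rewrite addnS -addSn.
Qed.

(** Unimodality, stated without choosing the position of a maximum. *)
Definition no_valley n (f : nat -> nat) :=
  forall i j k, i <= j -> j <= k -> k < n -> minn (f i) (f k) <= f j.

Definition overlapping n lo hi :=
  forall i, i.+1 < n -> lo i <= hi i.+1 /\ lo i.+1 <= hi i.

Definition row_convex n lo hi := forall i j k r, i <= j -> j <= k -> k < n ->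
  lo i <= r <= hi i -> lo k <= r <= hi k -> lo j <= r <= hi j.

(** If [hi] had a dip at [j], then by the two crossing lemmas row [(hi j).+1] would be met on both
    sides of [j], but not in column [j]. *)
Lemma row_convex_no_valley n lo hi : (forall i, i < n -> lo i <= hi i) ->
  overlapping n lo hi -> row_convex n lo hi -> no_valley n hi.
Proof.
move=> ne ov cvx i j k ij jk kn; rewrite leqNgt; apply/negP => lt.
have [] := @row_crossing_up lo hi i j (hi j).+1.
- by [].
- by move=> a ?; case: (ov a) => //; lia.
- lia.
- by have := ne j; lia.
move=> a aij ar.
have [] := @row_crossing_down lo hi j k (hi j).+1.
- by [].
- by move=> b ?; case: (ov b) => //; lia.
- by have := ne j; lia.
- lia.
move=> b bjk br.
have := @cvx a j b (hi j).+1; lia.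
Qed.

Lemma no_valley_row_convex n lo hi M : (forall i, i < n -> lo i <= M) ->
  no_valley n hi -> no_valley n (fun i => M - lo i) -> row_convex n lo hi.
Proof.
move=> leM vh vl i j k r ij jk kn ri rk.
have := vh i j k ij jk kn; have := vl i j k ij jk kn.
have := leM i; have := leM j; have := leM k; lia.
Qed.

(** The reflection of rows [r -> M - r] exchanges lower and upper boundaries. *)
Lemma row_convex_no_peak n lo hi M : (forall i, i < n -> lo i <= hi i) ->
  (forall i, i < n -> hi i <= M) ->
  overlapping n lo hi -> row_convex n lo hi -> no_valley n (fun i => M - lo i).
Proof.
move=> ne leM ov cvx.
apply: (@row_convex_no_valley n (fun i => M - hi i) (fun i => M - lo i)).
- by move=> i ilt; have := ne i ilt; lia.
- by move=> i ilt; have := ov i ilt; have := leM i; have := leM i.+1; lia.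
- move=> i j k r ij jk kn ri rk.
  have := cvx i j k (M - r) ij jk kn.
  have := ne i; have := ne j; have := ne k; have := leM i; have := leM j; have := leM k; lia.
Qed.

(** One-pass test for unimodality with known maximum [M]: the flag [r] records that [M] has been
    attained, and must be set at the end. *)
Fixpoint climb (M : nat) (r : bool) (x : nat) (s : seq nat) : bool :=
  if s is y :: s' then (if r then y <= x else x <= y) && climb M (r || (y == M)) y s'
  else r.

Lemma climb_down M x s : climb M true x s = path geq x s.
Proof. by elim: s x => //= y s IHs x; rewrite IHs. Qed.

Lemma climbP M x s : all (geq M) (x :: s) ->
  reflect (M \in x :: s /\ no_valley (size s).+1 (nth 0 (x :: s))) (climb M (x == M) x s).
Proof.
elim: s x => [|y s IHs] x /=.
  move=> _; rewrite inE eq_sym; apply: (iffP idP) => [xM|[]//]; split=> // i j k.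
  by case: i j k => [|i] [|j] [|k] //; rewrite geq_minl.
move=> /andP[xle /andP[yle sle]].
have [xM|xM] := eqVneq x M; [rewrite {x xle}xM|] => /=.
  rewrite climb_down -[(_ <= _) && _]/(path geq M (y :: s)).
  have -> : path geq M (y :: s) = sorted geq (M :: y :: s) by [].
  apply: (iffP idP) => [srt|[_ nv]].
    split=> [|i j k ij jk kn]; first by rewrite inE eqxx.
    have tr : transitive geq by move=> a b c /= ab bc; apply: leq_trans bc ab.
    have rf : reflexive geq by move=> a /=.
    have mono := sorted_leq_nth tr rf 0 srt.
    apply: leq_trans (geq_minr _ _) _; apply: mono; rewrite // inE /=; lia.
  apply/(sortedP 0) => i ilt.
  (* With the maximum [M] at index 0 as left end, the absence of valleys becomes monotonicity. *)
  have := nv 0 i i.+1 isT (leqnSn i) ilt; rewrite /=.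
  have : nth 0 (y :: s) i <= M.
    by apply: (allP (_ : all (geq M) (y :: s))); rewrite /= ?yle //; apply: mem_nth.
  by rewrite /geq /=; lia.
have {}IHs := IHs y; rewrite /= yle sle in IHs; have {IHs} IHs := IHs isT.
apply: (iffP andP) => [[xy /IHs[My nv]]|[My nv]].
  split=> [|[|i] [|j] [|k] ij jk kn //]; first by rewrite inE My orbT.
  - by rewrite geq_minl.
  - by rewrite geq_minl.
  - have := nv 0 j k isT jk kn; rewrite /=; lia.
  - exact: (nv i j k).
split.
  move: My; rewrite inE eq_sym (negPf xM) /= => My.
  have /(nthP 0)[k kn Mk] := My.
  (* The maximum lies further right, so the first step cannot go down. *)
  by have := nv 0 1 k.+1 isT isT kn; rewrite /= Mk; lia.
apply/IHs; split=> [|i j k ij jk kn]; first by move: My; rewrite inE eq_sym (negPf xM).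
exact: (nv i.+1 j.+1 k.+1).
Qed.
End Columns.

(** * Column sequences of convex polyominoes, tested from left to right *)

Section Profile.
Variable M : nat.
Implicit Types (c : nat * nat) (l : seq (nat * nat)).

Definition lo l i := (nth (0, 0) l i).1.
Definition hi l i := (nth (0, 0) l i).2.

Definition follows c c' := [&& c'.1 <= c'.2, c'.2 <= M, c'.1 <= c.2 & c.1 <= c'.2].

(** [rb] and [rt] record whether row 0 and row [M] have been reached. *)
Fixpoint steps (rb rt : bool) c l : bool :=
  if l is c' :: l' then
    [&& follows c c', (if rb then c.1 <= c'.1 else c'.1 <= c.1),
        (if rt then c'.2 <= c.2 else c.2 <= c'.2) & steps (rb || (c'.1 == 0)) (rt || (c'.2 == M)) c' l']
  else rb && rt.

Definition profile l : bool :=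
  if l is c :: l' then [&& c.1 <= c.2, c.2 <= M & steps (c.1 == 0) (c.2 == M) c l'] else false.

(** The two boundaries interact only through [follows]; reflected by [M - _], the lower one climbs
    just as the upper one does. *)
Lemma stepsE rb rt c l : c.1 <= M -> steps rb rt c l =
  [&& path follows c l, climb M rt c.2 (map snd l) & climb M rb (M - c.1) [seq M - d.1 | d <- l]].
Proof.
elim: l rb rt c => [|d l IHl] rb rt c cM /=; first by rewrite andbC.
case: (boolP (follows c d)) => //= /and4P[d12 d2M dc cd].
have dM : d.1 <= M by apply: leq_trans d2M.
rewrite IHl //.
have -> : (M - d.1 == M) = (d.1 == 0) by lia.
have -> : (if rb then M - d.1 <= M - c.1 else M - c.1 <= M - d.1) =
          (if rb then c.1 <= d.1 else d.1 <= c.1) by case: rb; lia.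
by case: (if rb then _ else _); case: (if rt then _ else _); rewrite /= ?andbF // andbCA.
Qed.

(** Links the left-to-right test, which the transfer recursion follows, with the global conditions
    that describe convexity of the set of cells. *)
Lemma profileP l : reflect
  [/\ forall i, i < size l -> lo l i <= hi l i <= M, overlapping (size l) (lo l) (hi l),
      no_valley (size l) (hi l), no_valley (size l) (fun i => M - lo l i) &
      (exists2 i, i < size l & lo l i = 0) /\ (exists2 i, i < size l & hi l i = M)]
  (profile l).
Proof.
case: l => [|c l]; first by apply: ReflectF => -[_ _ _ _ [[]]].
have mapE (f : nat * nat -> nat) i : i < (size l).+1 -> 
    nth 0 (f c :: map f l) i = f (nth (0, 0) (c :: l) i).
  by move=> ilt; rewrite -map_cons (nth_map (0, 0)).
have nvE (f : nat * nat -> nat) : no_valley (size (map f l)).+1 (nth 0 (f c :: map f l)) <->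
    no_valley (size l).+1 (fun i => f (nth (0, 0) (c :: l) i)).
  by rewrite size_map; split=> nv i j k ij jk kn; have := nv i j k ij jk kn; rewrite !mapE //; lia.
have exE (f : nat * nat -> nat) : M \in f c :: map f l <->
    exists2 i, i < (size l).+1 & f (nth (0, 0) (c :: l) i) = M.
  rewrite -map_cons; split=> [/mapP[d dl ->]|[i ilt <-]]; last by apply: map_f; apply: mem_nth.
  by exists (index d (c :: l)); rewrite ?index_mem ?nth_index //= -/(size (c :: l)) ?index_mem.
have z1 : (c.1 <= M) -> (c.1 == 0) = (M - c.1 == M) by lia.
apply: (iffP and3P) => [[c12 c2M]|[ne ov nvh nvl [ex0 exM]]].
  have c1M := leq_trans c12 c2M.
  rewrite stepsE // z1 // => /and3P[fl chi clo].
  have ne : forall i, i < (size l).+1 -> lo (c :: l) i <= hi (c :: l) i <= M.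
    move=> [|i] ilt; first by rewrite /lo /hi /= c12.
    by have /(pathP (0, 0))/(_ i ilt)/and4P[-> -> _ _] := fl.
  have alls (f : nat * nat -> nat) : (forall i, i < (size l).+1 -> f (nth (0, 0) (c :: l) i) <= M) ->
      all (geq M) (f c :: map f l).
    move=> fM; rewrite -map_cons; apply/allP => _ /mapP[d dl ->] /=.
    by rewrite -(nth_index (0, 0) dl); apply: fM; rewrite -/(size (c :: l)) index_mem.
  have /climbP := chi; case=> [|/exE exM /nvE nvh].
    by apply: (alls snd) => i /ne /andP[].
  have /climbP := clo; case=> [|/exE[i ilt iM] /nvE nvl].
    by apply: (alls (fun d => M - d.1)) => i _; rewrite leq_subr.
  split=> //.
    move=> a alt; have /(pathP (0, 0))/(_ a alt)/and4P[_ _ o1 o2] := fl.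
    by split.
  split=> //; exists i => //; have := ne i ilt; rewrite /lo /hi; lia.
have /andP[c12 c2M] : c.1 <= c.2 <= M by have := ne 0 isT.
have c1M := leq_trans c12 c2M.
rewrite c12 c2M; split=> //; rewrite stepsE // z1 //; apply/and3P; split.
- apply/(pathP (0, 0)) => i ilt; have [o1 o2] := ov i ilt; have := ne i.+1 ilt.
  by rewrite /follows /lo /hi /= => /andP[-> ->]; rewrite o1 o2.
- apply/climbP; last by split; [apply/exE | apply/nvE].
  apply/allP => d; rewrite -(map_cons snd) => /mapP[e el ->] /=.
  have := ne (index e (c :: l)); rewrite -/(size (c :: l)) index_mem /hi nth_index //.
  by move=> /(_ el)/andP[].
- apply/climbP; last split; last by apply/nvE.
    apply/allP => d; rewrite -(map_cons (fun d => M - d.1)) => /mapP[e el ->] /=.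
    exact: leq_subr.
  by apply/(exE (fun d => M - d.1)); case: ex0 => i ilt i0; exists i => //; rewrite -/(lo _ _) i0 subn0.
Qed.
End Profile.

(** * Convex polyominoes correspond to profiles *)

Section Polyomino.
Variables v M : nat.
Implicit Types (l : seq (nat * nat)) (S : {set 'I_v * 'I_M.+1}).

Definition cells l : {set 'I_v * 'I_M.+1} := [set c : 'I_v * 'I_M.+1 | lo l c.1 <= c.2 <= hi l c.1].

Lemma adjc_sym S : symmetric (adjc S).
Proof.
move=> c d; rewrite /adjc andbCA; congr [&& _, _ & _].
by rewrite [c.1 == _]eq_sym [c.2 == _]eq_sym [(_ == _) || _]orbC [(c.1.+1 == _) || _]orbC.
Qed.

Lemma adjc_vert S i (j k : 'I_M.+1) : (i, j) \in S -> (i, k) \in S ->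
  k = j.+1 :> nat -> adjc S (i, j) (i, k).
Proof. by move=> ij ik kj; rewrite /adjc ij ik /= !eqxx kj eqxx. Qed.

Lemma adjc_horiz S (i i' : 'I_v) j : (i, j) \in S -> (i', j) \in S ->
  i' = i.+1 :> nat -> adjc S (i, j) (i', j).
Proof. by move=> ij ik kj; rewrite /adjc ij ik /= !eqxx kj eqxx !orbT. Qed.

Lemma connect_column l (i : 'I_v) (j k : 'I_M.+1) : (i, j) \in cells l -> (i, k) \in cells l ->
  connect (adjc (cells l)) (i, j) (i, k).
Proof.
wlog jk : j k / j <= k => [hw ij ik|].
  have [jk|kj] := leqP j k; first exact: hw.
  by rewrite (sym_connect_sym (@adjc_sym _)) hw // ltnW.
move En : (k - j) => n; elim: n k En jk => [|n IHn] k En jk ij ik.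
  by have -> : k = j by apply: val_inj => /=; lia.
have k'P : k.-1 < M.+1 by have := ltn_ord k; lia.
have k'k : (i, Ordinal k'P) \in cells l by move: ij ik; rewrite !inE /=; lia.
apply: connect_trans (IHn (Ordinal k'P) _ _ ij k'k) (connect1 _); rewrite /=; try lia.
by apply: adjc_vert => //=; lia.
Qed.

Lemma connected_cells l : (forall i, i < v -> lo l i <= hi l i <= M) -> overlapping v (lo l) (hi l) ->
  connectedS (cells l).
Proof.
move=> ne ov; apply/forall_inP => c cS; apply/forall_inP => d dS.
wlog cd : c d cS dS / c.1 <= d.1 => [hw|].
  have [cd|dc] := leqP c.1 d.1; first exact: hw.
  by rewrite (sym_connect_sym (@adjc_sym _)) hw // ltnW.
move En : (d.1 - c.1) => n; elim: n d En cd dS => [|n IHn] [d1 d2] /= En cd dS.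
  case: c cS En cd => c1 c2 /= cS En cd.
  have cd1 : c1 = d1 by apply: val_inj => /=; lia.
  by rewrite cd1 in cS *; apply: connect_column.
have eP : d1.-1 < v by have := ltn_ord d1; lia.
have [|o1 o2] := ov d1.-1; first by have := ltn_ord d1; lia.
have d1S : d1.-1.+1 = d1 by lia.
rewrite d1S in o1 o2.
have := ne d1 (ltn_ord d1); have := ne _ eP => /andP[e1 e2] /andP[f1 f2].
(* The lowest row shared by the two columns serves as the passage between them. *)
have rP : maxn (lo l d1.-1) (lo l d1) < M.+1 by lia.
pose r := Ordinal rP; pose e := Ordinal eP.
have eS : (e, r) \in cells l by rewrite inE /=; lia.
have dS' : (d1, r) \in cells l by rewrite inE /=; lia.
apply: connect_trans (connect_column dS' dS).
apply: connect_trans (IHn (e, r) _ _ eS) (connect1 _) => /=; try lia.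
by apply: adjc_horiz.
Qed.

Lemma profile_convex l : size l = v -> profile M l -> is_convex_polyomino (cells l).
Proof.
move=> sl /profileP; rewrite sl => -[ne ov nvh nvl [[p pv p0] [q qv qM]]].
have lohi i : i < v -> lo l i <= hi l i by move=> /ne/andP[].
apply/and5P; split.
- apply/set0Pn; exists (Ordinal pv, ord0); rewrite inE /= p0 /=; exact: leq0n.
- exact: connected_cells.
- have leM i : i < v -> lo l i <= M by move=> /ne; lia.
  have cvx := no_valley_row_convex leM nvh nvl.
  apply/forallP => j; apply/forallP => a; apply/forallP => b; apply/forallP => c.
  apply/implyP => /and3P[]; rewrite !inE /= => aS cS /andP[ab bc].
  exact: (cvx a b c).
- apply/forallP => j; apply/forallP => a; apply/forallP => b; apply/forallP => c.
  apply/implyP => /and3P[]; rewrite !inE /=; lia.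
apply/andP; split; apply/forallP => i.
  have h := ne i (ltn_ord i); have loP : lo l i < M.+1 by lia.
  by apply/existsP; exists (Ordinal loP); rewrite inE /= leqnn; lia.
(* Column [p] touches row 0 and column [q] touches row [M]; row [i] is crossed on the way from one
   to the other. *)
suff [a av ar] : exists2 a, a < v & lo l a <= i <= hi l a.
  by apply/existsP; exists (Ordinal av); rewrite inE.
have iM : i <= M by rewrite -ltnS.
have [pq|qp] := leqP p q.
  have [|||a ab ar] := @row_crossing_down (lo l) (hi l) p q i pq; last by exists a => //; lia.
  - by move=> a ab; case: (ov a) => //; lia.
  - by rewrite p0.
  - by rewrite qM.
have [|||a ab ar] := @row_crossing_up (lo l) (hi l) q p i (ltnW qp); last by exists a => //; lia.
- by move=> a ab; case: (ov a) => //; lia.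
- by rewrite qM.
- by rewrite p0.
Qed.

Lemma column_interval S (i : 'I_v) : cols_convex S -> full_box S ->
  exists c : nat * nat, c.1 <= c.2 <= M /\ forall j : 'I_M.+1, ((i, j) \in S) = (c.1 <= j <= c.2).
Proof.
move=> /forallP/(_ i) cvx /andP[/forallP/(_ i)/existsP[j0 j0S] _].
have [a aS amin] := @arg_minnP _ j0 (fun j => (i, j) \in S) (fun j => j : nat) j0S.
have [b bS bmax] := @arg_maxnP _ j0 (fun j => (i, j) \in S) (fun j => j : nat) j0S.
exists (nat_of_ord a, nat_of_ord b); split=> [|j] /=.
  by have := bmax a aS; have := ltn_ord b; lia.
apply/idP/idP => [jS|jab]; first by have := bmax j jS; rewrite (amin _ jS).
have /forallP/(_ j)/forallP/(_ b)/implyP := forallP cvx a; apply.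
by rewrite aS bS.
Qed.

Lemma connected_overlap l : (forall i, i < v -> lo l i <= hi l i <= M) ->
  connectedS (cells l) -> overlapping v (lo l) (hi l).
Proof.
move=> ne con i ilt; pose i0 := Ordinal (ltnW ilt); pose i1 := Ordinal ilt.
have n0 := ne i (ltnW ilt); have n1 := ne i.+1 ilt.
have l0P : lo l i < M.+1 by lia.
have l1P : lo l i.+1 < M.+1 by lia.
have c0 : (i0, Ordinal l0P) \in cells l by rewrite inE /=; lia.
have c1 : (i1, Ordinal l1P) \in cells l by rewrite inE /=; lia.
have con01 : connect (adjc (cells l)) (i0, Ordinal l0P) (i1, Ordinal l1P).
  by have /forall_inP/(_ _ c0)/forall_inP/(_ _ c1) := con.
have [ov|nov] := boolP ((lo l i <= hi l i.+1) && (lo l i.+1 <= hi l i)); first by apply/andP.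
(* Without a common row no adjacency leads from column [i] to column [i.+1], so the columns up to
   [i] are closed under adjacency and separate the two chosen cells. *)
suff cl : closed (adjc (cells l)) [pred c : 'I_v * 'I_M.+1 | c.1 <= i].
  by have := closed_connect cl con01; rewrite !inE /= leqnn ltnn.
apply: (intro_closed (sym_connect_sym (@adjc_sym _))) => -[c1' c2] [d1 d2] /and3P[].
rewrite !inE /= => cS dS adj ci.
rewrite leqNgt; apply/negP => di.
have [/andP[/eqP c1d1 _]|/andP[/eqP c2d2 st]] := orP adj; first by move: di; rewrite -c1d1; lia.
have ci' : c1' = i :> nat by lia.
have di' : d1 = i.+1 :> nat by lia.
by rewrite ci' in cS; rewrite di' -c2d2 in dS; lia.
Qed.

Lemma convex_profile S : is_convex_polyomino S ->
  exists l, [/\ size l = v, profile M l & S = cells l].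
Proof.
move=> /and5P[S0 con rcvx ccvx full].
have /fin_all_exists[f fP] : forall i : 'I_v, exists c : nat * nat,
    c.1 <= c.2 <= M /\ forall j : 'I_M.+1, ((i, j) \in S) = (c.1 <= j <= c.2).
  by move=> i; apply: column_interval.
pose l := [seq f i | i <- enum 'I_v].
have sl : size l = v by rewrite size_map size_enum_ord.
have nl (i : 'I_v) : nth (0, 0) l i = f i.
  by rewrite (nth_map i) ?size_enum_ord // nth_ord_enum.
have Sl : S = cells l by apply/setP => -[i j]; rewrite inE /lo /hi /= nl; case: (fP i).
exists l; split=> //.
have ne i : i < v -> lo l i <= hi l i <= M.
  by move=> ilt; have := nl (Ordinal ilt); rewrite /lo /hi /= => ->; case: (fP (Ordinal ilt)).
rewrite {}Sl in S0 con rcvx ccvx full {fP}.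
have ov := connected_overlap ne con.
have cvx : row_convex v (lo l) (hi l).
  move=> a b c r ab bc cv ar cr.
  have rP : r < M.+1 by have := ne c cv; lia.
  have bv : b < v by lia.
  have av : a < v by lia.
  have /forallP/(_ (Ordinal av)) := forallP rcvx (Ordinal rP).
  move=> /forallP/(_ (Ordinal bv))/forallP/(_ (Ordinal cv))/implyP.
  by rewrite !inE /=; apply; rewrite ar cr ab bc.
have lohi i : i < v -> lo l i <= hi l i by move=> /ne/andP[].
have hiM i : i < v -> hi l i <= M by move=> /ne/andP[].
apply/profileP; rewrite sl; split=> //.
- exact: row_convex_no_valley lohi ov cvx.
- exact: row_convex_no_peak lohi hiM ov cvx.
have /andP[_ /forallP fr] := full.
split.
  have /existsP[i] := fr ord0; rewrite inE /= leqn0 => /andP[/eqP i0 _].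
  by exists i.
have /existsP[i] := fr ord_max; rewrite inE /= => /andP[_ Mi].
by exists i => //; apply/eqP; rewrite eqn_leq Mi hiM.
Qed.

Lemma cells_inj l l' : size l = v -> size l' = v -> profile M l -> profile M l' ->
  cells l = cells l' -> l = l'.
Proof.
move=> sl sl' /profileP; rewrite sl => -[ne _ _ _ _] /profileP; rewrite sl' => -[ne' _ _ _ _] E.
apply: (@eq_from_nth _ (0, 0)); rewrite sl ?sl' // => i ilt.
have /= h (j : 'I_M.+1) : (lo l i <= j <= hi l i) = (lo l' i <= j <= hi l' i).
  by move/setP/(_ (Ordinal ilt, j)): E; rewrite !inE.
have n := ne i ilt; have n' := ne' i ilt.
(* Membership tested at the four end points identifies the two non-empty intervals. *)
have in_ r (rM : r < M.+1) := h (Ordinal rM).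
have l1 := in_ (lo l i); have l2 := in_ (hi l i); have l3 := in_ (lo l' i); have l4 := in_ (hi l' i).
rewrite /= in l1 l2 l3 l4.
move: l1 l2 l3 l4 n n'; rewrite /lo /hi; case: (nth _ l i) (nth _ l' i) => [a b] [c d] /= l1 l2 l3 l4 n n'.
have {}l1 := l1 ltac:(lia); have {}l2 := l2 ltac:(lia).
have {}l3 := l3 ltac:(lia); have {}l4 := l4 ltac:(lia).
by congr pair; lia.
Qed.

Lemma cellin_cells l a b : (forall i, i < v -> hi l i <= M) ->
  cellin (cells l) a b = (a < v) && (lo l a <= b <= hi l a).
Proof.
move=> hiM; apply/exists_inP/andP => [[[i j]]|[av ab]].
  by rewrite inE /= => ij /andP[/eqP<- /eqP<-]; rewrite ltn_ord.
have bM : b < M.+1 by have := hiM a av; lia.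
by exists (Ordinal av, Ordinal bM); rewrite ?inE //= !eqxx.
Qed.

Lemma count_interval n a b : b < n -> \sum_(j < n | a < j <= b) 1 = b - a.
Proof.
move=> bn; rewrite sum1_card.
have -> : #|[pred j : 'I_n | a < j <= b]| = size (iota a.+1 (b - a)).
  rewrite cardE -(size_map val); apply: perm_size; apply: uniq_perm.
  - by rewrite map_inj_uniq ?enum_uniq //; apply: val_inj.
  - exact: iota_uniq.
  move=> j; rewrite mem_iota; apply/mapP/idP => [[i]|jab].
    by rewrite mem_enum inE => iab -> /=; lia.
  have jn : j < n by lia.
  by exists (Ordinal jn); rewrite // mem_enum inE /=; lia.
by rewrite size_iota.
Qed.

(** On the line between two neighbouring columns the interior vertices separate consecutive shared
    rows, so there is one fewer of them than of shared rows. *)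
Lemma int_vertices_cells l : size l = v -> profile M l ->
  int_vertices (cells l) = \sum_(i < v.-1) (minn (hi l i) (hi l i.+1) - maxn (lo l i) (lo l i.+1)).
Proof.
move=> sl /profileP; rewrite sl => -[ne _ _ _ _].
have hiM i : i < v -> hi l i <= M by move=> /ne/andP[].
rewrite /int_vertices -sum1_card.
transitivity (\sum_(i < v | 0 < i)
  \sum_(j < M.+1 | maxn (lo l i.-1) (lo l i) < j <= minn (hi l i.-1) (hi l i)) 1).
  rewrite pair_big_dep; apply: eq_bigl => -[i j]; rewrite inE /= !cellin_cells // ltn_ord.
  have -> : i.-1 < v by have := ltn_ord i; lia.
  by rewrite /=; lia.
case: v ne hiM => [|n] ne hiM; first by rewrite !big_ord0.
rewrite big_mkcond big_ord_recl /= add0n; apply: eq_bigr => i _.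
rewrite count_interval; first by rewrite /bump /= add1n.
by rewrite /bump /= add1n; have := hiM i.+1; have := ltn_ord i; lia.
Qed.
End Polyomino.

(** * Enumeration of profiles and the transfer recursion *)

Fixpoint lists (T : Type) (s : seq T) (n : nat) : seq (seq T) :=
  if n is n'.+1 then [seq x :: l | x <- s, l <- lists s n'] else [:: [::]].

Lemma mem_lists (T : eqType) (s : seq T) n l : (l \in lists s n) = (size l == n) && all (mem s) l.
Proof.
elim: n l => [|n IHn] [|x l] //=.
  by apply/allpairsP => -[[y m] /= [_ _]].
apply/allpairsP/andP => [[[y m] /= [ys ml [-> ->]]]|[sl /andP[xs ls]]].
  by move: ml; rewrite IHn => /andP[/eqP-> ->]; rewrite eqxx ys.
by exists (x, l); split=> //=; rewrite IHn -eqSS sl ls.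
Qed.

Lemma lists_uniq (T : eqType) (s : seq T) n : uniq s -> uniq (lists s n).
Proof.
move=> us; elim: n => //= n IHn; apply: allpairs_uniq => // -[x l] [y m] _ _ [] -> -> //.
Qed.

(** Change of variable with an explicit inverse [g], so that each use leaves only linear
    arithmetic. *)
Lemma sum_nat_reindex n (P : pred nat) m f g (F : nat -> nat) :
  (forall j, j < m -> [/\ f j < n, P (f j) & g (f j) = j]) ->
  (forall i, i < n -> P i -> g i < m /\ f (g i) = i) ->
  \sum_(0 <= i < n | P i) F i = \sum_(j < m) F (f j).
Proof.
move=> fg gf; rewrite -(big_mkord xpredT (fun j => F (f j))) -(big_map f xpredT F) -big_filter.
apply: perm_big; apply: uniq_perm.
- by rewrite filter_uniq // iota_uniq.
- rewrite map_inj_in_uniq ?iota_uniq // => i j.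
  by rewrite !mem_index_iota /= => /fg[_ _ {2}<-] /fg[_ _ {2}<-] ->.
move=> i; rewrite mem_filter mem_index_iota /=; apply/andP/mapP => [[Pi ilt]|[j]].
  by have [gm fgi] := gf i ilt Pi; exists (g i); rewrite // mem_index_iota.
by rewrite mem_index_iota /= => /fg[fn Pf _] ->.
Qed.

Ltac reindex_lia := move=> ? ? /= *; split; lia.

(* Sum of [e] plus the number of interior vertices added, over the ways of continuing a column of height
   [k] by [n] columns, with [d] and [u] rows left to reach below and above it. *)
Fixpoint tails (n d u k e : nat) : nat :=
  if n is n'.+1 then
    if (d == 0) && (u == 0) then \sum_(m < k) \sum_(j < m.+1) tails n' 0 0 j.+1 (e + j)
    else if d == 0 then \sum_(m < k) \sum_(i < u.+1) tails n' 0 (u - i) (m.+1 + i) (e + m)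
    else if u == 0 then \sum_(m < k) \sum_(i < d.+1) tails n' (d - i) 0 (m.+1 + i) (e + m)
    else \sum_(i < d.+1) \sum_(j < u.+1) tails n' (d - i) (u - j) (k + i + j) (e + k.-1)
  else if (d == 0) && (u == 0) then e else 0.

(** Reflection upside down. It lets the [slide] counts serve for either side. *)
Lemma tails_sym n d u k e : tails n d u k e = tails n u d k e.
Proof.
elim: n d u k e => [|n IHn] d u k e /=; first by rewrite andbC.
case: d u => [|d] [|u] //=.
- by apply: eq_bigr => m _; apply: eq_bigr => i _.
- by apply: eq_bigr => m _; apply: eq_bigr => i _.
rewrite exchange_big; apply: eq_bigr => i _; apply: eq_bigr => j _.
by rewrite IHn addnAC.
Qed.

Section Transfer.
Variable M : nat.
Implicit Types (c : nat * nat) (l : seq (nat * nat)).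

Definition columns := [seq (b, t) | b <- index_iota 0 M.+1, t <- index_iota 0 M.+1].

Arguments columns : simpl never.

Fixpoint weight c l : nat :=
  if l is d :: l' then (minn c.2 d.2 - maxn c.1 d.1) + weight d l' else 0.

Definition completions n rb rt c e : nat :=
  \sum_(l <- lists columns n | steps M rb rt c l) (e + weight c l).

Arguments completions : simpl never.

Lemma completionsS n rb rt c e : completions n.+1 rb rt c e =
  \sum_(0 <= b < M.+1) \sum_(0 <= t < M.+1 | [&& follows M c (b, t),
        (if rb then c.1 <= b else b <= c.1) & (if rt then t <= c.2 else c.2 <= t)])
    completions n (rb || (b == 0)) (rt || (t == M)) (b, t) (e + (minn c.2 t - maxn c.1 b)).
Proof.
rewrite /completions big_mkcond big_allpairs_dep /columns big_allpairs; apply: eq_bigr => b _.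
rewrite [RHS]big_mkcond; apply: eq_bigr => t _ /=.
case: (follows M c (b, t)) => /=; last by rewrite big1.
case: (if rb then _ else _) => /=; last by rewrite big1.
case: (if rt then _ else _) => /=; last by rewrite big1.
by rewrite -big_mkcond; apply: eq_bigr => l _; rewrite addnA.
Qed.

(** Only the height and the two distances matter. The hypotheses exclude a boundary on row 0 or [M]
    whose flag is not set; the four values of the flags give the four cases of [tails]. *)
Lemma completionsE n (rb rt : bool) c e : c.1 <= c.2 <= M -> rb || (0 < c.1) -> rt || (c.2 < M) ->
  completions n rb rt c e =
  tails n (if rb then 0 else c.1) (if rt then 0 else M - c.2) (c.2 - c.1).+1 e.
Proof.
elim: n rb rt c e => [|n IHn] rb rt [b t] e /= /andP[bt tM] hb ht.
  rewrite /completions big_cons big_nil /= !addn0.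
  by case: rb hb => /= hb; case: rt ht => /= ht //; case: ifP => //; lia.
have IH b' t' e' : b' <= t' <= M -> completions n (rb || (b' == 0)) (rt || (t' == M)) (b', t') e' =
    tails n (if rb then 0 else b') (if rt then 0 else M - t') (t' - b').+1 e'.
  move=> h; rewrite IHn //=; first last.
  - by rewrite -orbA -leq_eqVlt; case/andP: h => _ ->; rewrite orbT.
  - by case: (b') => [|?]; rewrite ?orbT.
  by congr tails; [case: rb {hb} => //=; case: eqP|case: rt {ht} => //=; case: eqP => // ->; rewrite subnn].
rewrite completionsS /follows /=.
under eq_bigr => b' _ do under eq_bigr => t' /and3P[/and4P[h1 h2 _ _] _ _] do
  (rewrite IH; last by rewrite h1 h2).
case: rb hb {IH} => /= hb; case: rt ht => /= ht.
(* Both sides reached: lowering the top leaves [m.+1] rows, and raising the bottom then leaves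
   [j.+1]. *)
- rewrite (exchange_big_dep xpredT) //=.
  transitivity (\sum_(0 <= t' < M.+1 | b <= t' <= t) \sum_(0 <= b' < M.+1 | b <= b' <= t')
     tails n 0 0 (t' - b').+1 (e + (minn t t' - maxn b b'))).
    rewrite [RHS]big_mkcond; apply: eq_bigr => t' _; case: ifP => h.
      by apply: eq_bigl => b'; lia.
    by rewrite big1 // => b'; lia.
  rewrite (@sum_nat_reindex _ _ (t - b).+1 (addn b) (subn^~ b)); [|reindex_lia|reindex_lia].
  apply: eq_bigr => m _; have mP := ltn_ord m.
  rewrite (@sum_nat_reindex _ _ m.+1 (fun j => b + m - j) (fun b' => b + m - b')); [|reindex_lia|reindex_lia].
  by apply: eq_bigr => j _; congr tails; have := ltn_ord m; have := ltn_ord j; lia.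
(* Only the bottom reached: raising it leaves [m.+1] of the old rows, and the top moves out by [j].
   The next case is its mirror image. *)
- transitivity (\sum_(0 <= b' < M.+1 | b <= b' <= t) \sum_(0 <= t' < M.+1 | t <= t' <= M)
     tails n 0 (M - t') (t' - b').+1 (e + (minn t t' - maxn b b'))).
    rewrite [RHS]big_mkcond; apply: eq_bigr => b' _; case: ifP => h.
      by apply: eq_bigl => t'; lia.
    by rewrite big1 // => t'; lia.
  have -> : (M - t == 0) = false by lia.
  rewrite (@sum_nat_reindex _ _ (t - b).+1 (fun m => t - m) (fun b' => t - b')); [|reindex_lia|reindex_lia].
  apply: eq_bigr => m _; have mP := ltn_ord m.
  rewrite (@sum_nat_reindex _ _ (M - t).+1 (addn t) (subn^~ t)); [|reindex_lia|reindex_lia].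
  by apply: eq_bigr => j _; congr tails; have := ltn_ord m; have := ltn_ord j; lia.
- rewrite (exchange_big_dep xpredT) //=.
  transitivity (\sum_(0 <= t' < M.+1 | b <= t' <= t) \sum_(0 <= b' < M.+1 | b' <= b)
     tails n b' 0 (t' - b').+1 (e + (minn t t' - maxn b b'))).
    rewrite [RHS]big_mkcond; apply: eq_bigr => t' _; case: ifP => h.
      by apply: eq_bigl => b'; lia.
    by rewrite big1 // => b'; lia.
  have -> : (b == 0) = false by lia.
  rewrite (@sum_nat_reindex _ _ (t - b).+1 (addn b) (subn^~ b)); [|reindex_lia|reindex_lia].
  apply: eq_bigr => m _; have mP := ltn_ord m.
  rewrite (@sum_nat_reindex _ _ b.+1 (fun i => b - i) (fun b' => b - b')); [|reindex_lia|reindex_lia].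
  by apply: eq_bigr => j _; congr tails; have := ltn_ord m; have := ltn_ord j; lia.
transitivity (\sum_(0 <= b' < M.+1 | b' <= b) \sum_(0 <= t' < M.+1 | t <= t' <= M)
     tails n b' (M - t') (t' - b').+1 (e + (minn t t' - maxn b b'))).
  rewrite [RHS]big_mkcond; apply: eq_bigr => b' _; case: ifP => h.
    by apply: eq_bigl => t'; lia.
  by rewrite big1 // => t'; lia.
have -> : (M - t == 0) = false by lia.
have -> : (b == 0) = false by lia.
rewrite (@sum_nat_reindex _ _ b.+1 (fun i => b - i) (fun b' => b - b')); [|reindex_lia|reindex_lia].
apply: eq_bigr => m _; have mP := ltn_ord m.
rewrite (@sum_nat_reindex _ _ (M - t).+1 (addn t) (subn^~ t)); [|reindex_lia|reindex_lia].
by apply: eq_bigr => j _; congr tails; have := ltn_ord m; have := ltn_ord j; lia.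
Qed.

Lemma weightE c l : weight c l =
  \sum_(i < size l) (minn (hi (c :: l) i) (hi (c :: l) i.+1) - maxn (lo (c :: l) i) (lo (c :: l) i.+1)).
Proof.
elim: l c => [|d l IHl] c /=; first by rewrite big_ord0.
by rewrite big_ord_recl IHl.
Qed.

(** Polyominoes are sorted by their first column [(b, t)], which contributes no interior vertex by
    itself and decides the initial flags. *)
Lemma int_sum_completions v : int_sum v.+1 M.+1 =
  \sum_(0 <= b < M.+1) \sum_(0 <= t < M.+1 | b <= t) completions v (b == 0) (t == M) (b, t) 0.
Proof.
pose L := [seq l <- lists columns v.+1 | profile M l].
have memL l : (l \in L) = (size l == v.+1) && profile M l.
  rewrite mem_filter mem_lists andbC; case: eqP => //= sl.
  case: profileP => [[ne _ _ _ _]|] /=; last by rewrite andbF.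
  rewrite andbT; apply/allP => c cl; have := ne (index c l).
  rewrite index_mem /lo /hi nth_index // => /(_ cl) h.
  apply/allpairsP; exists c; rewrite !mem_index_iota /=; split; [lia|lia|by case: c {h cl}].
transitivity (\sum_(S <- [seq cells v.+1 M l | l <- L]) int_vertices S).
  rewrite /int_sum -[LHS]big_filter; apply: perm_big; apply: uniq_perm.
  - by rewrite filter_uniq // /index_enum -enumT enum_uniq.
  - rewrite map_inj_in_uniq ?filter_uniq ?lists_uniq //.
      by apply: allpairs_uniq; rewrite ?iota_uniq // => -[? ?] [].
    move=> l m; rewrite !memL => /andP[/eqP sl pl] /andP[/eqP sm pm]; exact: cells_inj.
  move=> S; rewrite mem_filter mem_index_enum andbT.
  apply/idP/mapP => [/convex_profile[l [sl pl ->]]|[l]].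
    by exists l => //; rewrite memL sl eqxx.
  by rewrite memL => /andP[/eqP sl pl] ->; apply: profile_convex.
rewrite big_map /L big_filter.
rewrite big_mkcond big_allpairs_dep /columns big_allpairs; apply: eq_bigr => b _.
rewrite [RHS]big_mkcond /=; apply: eq_big_nat => t /= tM.
case: (leqP b t) => /= bt; last by rewrite big1.
rewrite -ltnS tM /= -big_mkcond /=.
rewrite /completions big_seq_cond [RHS]big_seq_cond; apply: eq_bigr => l.
rewrite mem_lists => /andP[/andP[/eqP sl _] st].
rewrite int_vertices_cells /= ?sl //; last by rewrite bt -ltnS tM.
by rewrite weightE sl.
Qed.

(** The first column has height [k + i], and the rows it leaves are split into [d] below and
    [s - i - d] above. Only [k = 1] is wanted; a general [k] makes a recurrence by unit steps
    possible. *)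
Definition start n s k e := \sum_(i < s.+1) \sum_(d < (s - i).+1) tails n d (s - i - d) (k + i) e.

Lemma int_sumE v : int_sum v.+1 M.+1 = start v M 1 0.
Proof.
rewrite int_sum_completions.
transitivity (\sum_(0 <= b < M.+1) \sum_(0 <= t < M.+1 | b <= t) tails v b (M - t) (t - b).+1 0).
  apply: eq_big_nat => b bM; rewrite big_nat_cond [RHS]big_nat_cond; apply: eq_bigr => t /andP[tM bt].
  rewrite completionsE /=; [|lia|lia|lia].
  by congr tails; case: eqP => // ->; rewrite subnn.
transitivity (\sum_(0 <= b < M.+1) \sum_(0 <= i < M.+1 | b + i <= M) tails v b (M - i - b) i.+1 0).
  apply: eq_big_nat => b bM.
  rewrite (@sum_nat_reindex _ _ (M - b).+1 (addn b) (subn^~ b)); [|reindex_lia|reindex_lia].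
  rewrite (@sum_nat_reindex _ _ (M - b).+1 id id); [|reindex_lia|reindex_lia].
  by apply: eq_bigr => j _; congr tails; lia.
rewrite (exchange_big_dep xpredT) //= big_mkord; apply: eq_bigr => i _.
have iM := ltn_ord i; rewrite (@sum_nat_reindex _ _ (M - i).+1 id id); [|reindex_lia|reindex_lia].
by apply: eq_bigr => j _; rewrite add1n.
Qed.
End Transfer.

(** * Recurrences by unit steps *)

(* In all the counts below [n] is the number of columns to come and [u] or [s] the number of rows left to
   reach; a suffix [_top] or [_both] means that the sides named have already been chosen for the next column. *)
Definition shrink n u k e := if u == 0 then tails n 0 0 k e else 0.
Definition shrink_top n u k e := if u == 0 then \sum_(j < k) tails n 0 0 j.+1 (e + j) else 0.
Definition slide n u k e := if u == 0 then 0 else tails n 0 u k e.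
Definition slide_top n u k e := if u == 0 then 0 else \sum_(i < u.+1) tails n 0 (u - i) (k + i) e.
Definition grow n s k e := \sum_(1 <= d < s) tails n d (s - d) k e.
Definition grow_top n s k e := \sum_(1 <= d < s) \sum_(j < (s - d).+1) tails n d (s - d - j) (k + j) e.
Definition grow_both n s k e :=
  \sum_(1 <= d < s) \sum_(i < d.+1) \sum_(j < (s - d).+1)
    tails n (d - i) (s - d - j) (k + i + j) e.

Lemma shrink_0 u k e : shrink 0 u k e = if u == 0 then e else 0.
Proof. by case: u. Qed.

Lemma shrink_k0 n u e : shrink n.+1 u 0 e = 0.
Proof. by case: u => //; rewrite /shrink /= big_ord0. Qed.

Lemma shrink_kS n u k e : shrink n.+1 u k.+1 e = shrink n.+1 u k e + shrink_top n u k.+1 e.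
Proof. by case: u => //; rewrite /shrink /= big_ord_recr. Qed.

Lemma shrink_top_k0 n u e : shrink_top n u 0 e = 0.
Proof. by case: u => //; rewrite /shrink_top big_ord0. Qed.

Lemma shrink_top_kS n u k e : shrink_top n u k.+1 e = shrink_top n u k e + shrink n u k.+1 (e + k).
Proof. by case: u => //; rewrite /shrink_top big_ord_recr. Qed.

Lemma slide_0 u k e : slide 0 u k e = 0.
Proof. by case: u. Qed.

Lemma slide_k0 n u e : slide n.+1 u 0 e = 0.
Proof. by case: u => // u; rewrite /slide /= big_ord0. Qed.

Lemma slide_kS n u k e : slide n.+1 u k.+1 e = slide n.+1 u k e + slide_top n u k.+1 (e + k).
Proof. by case: u => // u; rewrite /slide /= big_ord_recr. Qed.

Lemma slide_top_u0 n k e : slide_top n 0 k e = slide n 0 k e.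
Proof. by []. Qed.

(** The top either stays or moves out by one more row. If that row was the last, [shrink] takes
    over: for each [u] at most one of the two terms in parentheses is non-zero. *)
Lemma slide_top_uS n u k e :
  slide_top n u.+1 k e = slide n u.+1 k e + (shrink n u k.+1 e + slide_top n u k.+1 e).
Proof.
rewrite /slide_top /slide /shrink [u.+1 == 0]/= big_ord_recl subn0 addn0; congr (_ + _).
under eq_bigr => i _ do rewrite lift0 subSS addnS -addSn.
by case: u => [|u] /=; rewrite ?add0n // big_ord_recl big_ord0 !addn0.
Qed.

Lemma grow_0 s k e : grow 0 s k e = 0.
Proof. by rewrite /grow big_nat big1 // => d; rewrite /= => ?; case: ifP => //; lia. Qed.

Lemma grow_S n s k e : grow n.+1 s k e = grow_both n s k (e + k.-1).
Proof.
rewrite /grow /grow_both; apply: eq_big_nat => d dP /=.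
have -> : (d == 0) = false by lia.
by have -> : (s - d == 0) = false by lia.
Qed.

Lemma grow_top_u0 n k e : grow_top n 0 k e = grow n 0 k e.
Proof. by rewrite /grow_top /grow !big_geq. Qed.

(** Moving the top out by one row lowers [s]. In the summand where this was the last row above, only
    the lower side stays open, which [slide] counts by [tails_sym]. *)
Lemma grow_top_uS n s k e :
  grow_top n s.+1 k e = grow n s.+1 k e + (grow_top n s k.+1 e + slide n s k.+1 e).
Proof.
rewrite /grow_top /grow.
have -> : \sum_(1 <= d < s) \sum_(j < (s - d).+1) tails n d (s - d - j) (k.+1 + j) e + slide n s k.+1 e =
          \sum_(1 <= d < s.+1) \sum_(j < (s - d).+1) tails n d (s - d - j) (k.+1 + j) e.
  case: s => [|s]; first by rewrite !big_geq.
  rewrite [RHS]big_nat_recr //=; congr (_ + _).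
  by rewrite subnn big_ord_recl big_ord0 !addn0 tails_sym.
rewrite -big_split /=; apply: eq_big_nat => d dP.
rewrite subSn; last by lia.
rewrite big_ord_recl subn0 addn0; congr (_ + _); apply: eq_bigr => j _.
by rewrite lift0 subSS addnS addSn.
Qed.

Lemma grow_both_u0 n k e : grow_both n 0 k e = grow_top n 0 k e.
Proof. by rewrite /grow_top /grow_both !big_geq. Qed.

(** The same for the lower side: after the shift of [d], the new summand [d = 0] has nothing left
    below and is [slide_top]. *)
Lemma grow_both_uS n s k e :
  grow_both n s.+1 k e = grow_top n s.+1 k e + (grow_both n s k.+1 e + slide_top n s k.+1 e).
Proof.
rewrite /grow_both /grow_top.
have -> : \sum_(1 <= d < s) \sum_(i < d.+1) \sum_(j < (s - d).+1)
       tails n (d - i) (s - d - j) (k.+1 + i + j) e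
     + slide_top n s k.+1 e =
    \sum_(0 <= d < s) \sum_(i < d.+1) \sum_(j < (s - d).+1) tails n (d - i) (s - d - j) (k.+1 + i + j) e.
  case: s => [|s]; first by rewrite !big_geq.
  rewrite [RHS]big_ltn // addnC; congr (_ + _).
  by rewrite big_ord_recl big_ord0 !addn0 subn0.
rewrite !(big_add1 _ _ 0 s.+1) /= -big_split; apply: eq_big_nat => d dP /=.
rewrite big_ord_recl subn0 !subSS; congr (_ + _).
  by apply: eq_bigr => j _; rewrite addn0.
by apply: eq_bigr => i _; apply: eq_bigr => j _; rewrite lift0 subSS addnS addSn.
Qed.

Definition total n s k e := \sum_(d < s.+1) tails n d (s - d) k e.
(** The extreme splits [d = 0] and [d = s] give one [slide] each; for [s = 0] they coincide and give
    [shrink]. *)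
Lemma totalE n s k e : total n s k e = grow n s k e + slide n s k e + slide n s k e + shrink n s k e.
Proof.
case: s => [|s]; rewrite /total /grow /slide /shrink.
  by rewrite big_ord_recl big_ord0 big_geq //= !addn0.
rewrite -(big_mkord xpredT (fun d => tails n d (s.+1 - d) k e)) big_ltn // big_nat_recr //=.
by rewrite subn0 subnn addn0 [tails n _.+1 0 _ _]tails_sym; lia.
Qed.

Lemma start_u0 n k e : start n 0 k e = total n 0 k e.
Proof. by rewrite /start big_ord_recl big_ord0 addn0 subn0 addn0. Qed.

Lemma start_uS n s k e : start n s.+1 k e = total n s.+1 k e + start n s k.+1 e.
Proof.
rewrite /start big_ord_recl subn0 addn0; congr (_ + _); apply: eq_bigr => i _.
by rewrite lift0 subSS addnS addSn.
Qed.

From Stdlib Require Import Reals Lra.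
From Coquelicot Require Import Coquelicot.
Open Scope R_scope.

(** * Closed forms over the quadratic extension by a square root of [x] *)

Section QuadraticExtension.
Variable x : R.

(* The pair [(a, b)] stands for [a + b z] with [z ^ 2 = x], whatever the sign of [x]. *)
Definition zadd (a b : R * R) : R * R := (a.1 + b.1, a.2 + b.2).
Definition zopp (a : R * R) : R * R := (- a.1, - a.2).
Definition zsub (a b : R * R) : R * R := (a.1 - b.1, a.2 - b.2).
Definition zmul (a b : R * R) : R * R :=
  (a.1 * b.1 + x * (a.2 * b.2), a.1 * b.2 + a.2 * b.1).
Definition zcst (c : R) : R * R := (c, 0).
Definition zroot : R * R := (0, 1).

Lemma zext_theory : ring_theory (zcst 0) (zcst 1) zadd zmul zsub zopp eq.
Proof.
split=> [[a a']|[a a'] [b b']|[a a'] [b b'] [c c']|[a a']|[a a'] [b b']|[a a'] [b b'] [c c']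
  |[a a'] [b b'] [c c']|[a a'] [b b']|[a a']]; rewrite /zadd /zmul /zsub /zopp /zcst /=; congr pair; ring.
Qed.

Lemma zext_morph : ring_morph (zcst 0) (zcst 1) zadd zmul zsub zopp eq
  Z0 (Zpos 1) Z.add Z.mul Z.sub Z.opp Z.eqb (fun n => zcst (IZR n)).
Proof.
split => //= [a b|a b|a b|a|a b].
- by rewrite plus_IZR /zadd /zcst /= Rplus_0_r.
- by rewrite minus_IZR /zsub /zcst /= Rminus_0_r.
- by rewrite mult_IZR /zmul /zcst /=; congr pair; ring.
- by rewrite opp_IZR /zopp /zcst /= Ropp_0.
- by move=> /Z.eqb_eq ->.
Qed.

Declare Scope zext_scope.
Delimit Scope zext_scope with zx.
Local Notation "a + b" := (zadd a b) : zext_scope.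
Local Notation "a * b" := (zmul a b) : zext_scope.
Local Notation "a - b" := (zsub a b) : zext_scope.
Local Notation "- a" := (zopp a) : zext_scope.
Local Notation "n %:z" := (zcst n) (at level 2, format "n %:z") : zext_scope.
Local Notation z := zroot.

Fixpoint zpow (a : R * R) n := if n is n'.+1 then zmul a (zpow a n') else zcst 1.
Local Notation "a ^ n" := (zpow a n) : zext_scope.

Ltac zext_cst t :=
  match t with
  | zcst (IZR ?n) =>
      match isZcst n with true => n | _ => constr:(InitialRing.NotConstant) end
  | _ => constr:(InitialRing.NotConstant)
  end.
Add Ring zext_ring : zext_theory (morphism zext_morph, constants [zext_cst]).

Variable y : R.
Local Notation Y := (zcst y).
Local Notation v := (1%:z - z)%zx.
Local Notation q := (v * v - Y)%zx.
Local Notation q' := ((1%:z + z) * (1%:z + z) - Y)%zx.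

Definition discr := (1 + x - y) ^ 2 - 4 * x.

(** [q'] is the conjugate of [q], so the product is a norm and has no [z]-part. *)
Lemma conj_discr : (q * q')%zx = discr%:z%zx.
Proof. rewrite /zmul /zsub /zadd /zcst /zroot /discr /=; congr pair; ring. Qed.

(* [base k] is [t ^ k.+1 / q ^ 4] with [t = 1 / (1 - z)]. *)
Definition base0 : R * R := ((/ ((1 - x) * discr ^ 4))%:z * (1%:z + z) * q' ^ 4)%zx.

Fixpoint base (k : nat) : R * R :=
  if k is k'.+1 then ((/ (1 - x))%:z * (1%:z + z) * base k')%zx else base0.

Definition quad_part (G0 G1 G2 Ge : R * R) (k : nat) (e : R) : R :=
  ((G0 + (INR k)%:z * G1 + (INR k)%:z * (INR k)%:z * G2 + 4%:z * e%:z * Ge) * base k)%zx.2 / 4.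

(* The closed forms below, and those of [KernelRoot], were found by undetermined coefficients.  [f t ^ k] plus
   its conjugate is twice the [z]-coefficient of [z f t ^ k], which also makes sense if [f] has a pole at [z = 0]. *)
Definition shrink_z := quad_part (v * q^4)%zx (- z * q^4)%zx (z^2 * q^4)%zx (z * v * q^4)%zx.

Definition shrink_top_z :=
  quad_part (- v * q^4)%zx ((1%:z - 2%:z * z) * q^4)%zx (z * q^4)%zx (v * q^4)%zx.

Definition slide_z := quad_part
  (Y * z^2 * v * ((-7)%:z + Y + 8%:z * z - z^2) * q^2)%zx
  (Y * z^2 * (1%:z - Y + 2%:z * Y * z - 3%:z * z^2 + 2%:z * z^3) * q^2)%zx
  (Y * z^3 * q^3)%zx
  (Y * z^2 * v * q^3)%zx.

Definition slide_top_z := quad_part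
  (Y * v * (1%:z - Y - 4%:z * z - z^2 + 4%:z * z^3) * q^2)%zx
  (Y * z * ((-1)%:z + Y + 6%:z * z - 9%:z * z^2 + 4%:z * z^3) * q^2)%zx
  (Y * z^2 * q^3)%zx
  (Y * z * v * q^3)%zx.

Definition grow_both_z := quad_part
  (Y^2 * v * (1%:z - 2%:z * Y - 8%:z * z + Y^2 + 8%:z * Y * z + 18%:z * z^2 + 2%:z * Y * z^2
              - 16%:z * z^3 - 8%:z * Y * z^3 + 5%:z * z^4))%zx
  (Y^2 * z * ((-1)%:z + Y + 10%:z * z - 17%:z * z^2 + 8%:z * z^3) * q)%zx
  (Y^2 * z^2 * q^2)%zx
  (Y^2 * z * v * q^2)%zx.

Definition grow_top_z := quad_part
  (Y^2 * z^2 * v * ((-5)%:z + 6%:z * Y + 16%:z * z - Y^2 - 18%:z * z^2 - 6%:z * Y * z^2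
                    + 8%:z * z^3 - z^4))%zx
  (Y^2 * z^2 * (1%:z - Y + 4%:z * z + 2%:z * Y * z - 11%:z * z^2 + 6%:z * z^3) * q)%zx
  (Y^2 * z^3 * q^2)%zx
  (Y^2 * z^2 * v * q^2)%zx.

Definition start_c0 : R * R :=
  (1%:z - 3%:z * Y - 6%:z * z + 3%:z * Y^2 + 10%:z * z * Y + 15%:z * z^2 - Y^3 - 2%:z * z * Y^2
   - 23%:z * z^2 * Y - 20%:z * z^3 - 2%:z * z * Y^3 + 17%:z * z^2 * Y^2 + 40%:z * z^3 * Y
   + 15%:z * z^4 - 9%:z * z^2 * Y^3 - 20%:z * z^3 * Y^2 - 37%:z * z^4 * Y - 6%:z * z^5
   + 2%:z * z^4 * Y^2 + 14%:z * z^5 * Y + z^6 - z^6 * Y)%zx.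

Definition start_c1 : R * R :=
  ((-1)%:z + 2%:z * Y + 3%:z * z - Y^2 + 3%:z * z * Y - 3%:z * z^2 - 6%:z * z * Y^2
   - 3%:z * z^2 * Y + z^3 - 2%:z * z^3 * Y)%zx.

Definition start_z := quad_part
  (v^3 * start_c0)%zx
  (v^3 * z * q * start_c1)%zx
  (v^3 * z^2 * q^2 * (1%:z - Y - z))%zx
  (z * v^4 * (v - Y) * q^2)%zx.

Hypothesis x_neq1 : 1 - x <> 0.

Lemma baseS k : base k = (v * base k.+1)%zx.
Proof.
rewrite /= /zmul /zsub /zadd /zcst /zroot /=; case: (base k) => a b /=.
congr pair; field; exact: x_neq1.
Qed.

Lemma zmul_x a : x * (a.2 / 4) = (z * z * a)%zx.2 / 4.
Proof. rewrite /zmul /zroot /=; field. Qed.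

Lemma zmul_c c a : c * (a.2 / 4) = (c%:z * a)%zx.2 / 4.
Proof. rewrite /zmul /zcst /=; field. Qed.

Lemma zadd_2 a b : a.2 / 4 + b.2 / 4 = (a + b)%zx.2 / 4.
Proof. rewrite /zadd /=; field. Qed.

Lemma zcstD a b : (a + b)%:z%zx = (a%:z + b%:z)%zx.
Proof. rewrite /zadd /zcst /=; congr pair; ring. Qed.

Lemma zcstB a b : (a - b)%:z%zx = (a%:z - b%:z)%zx.
Proof. rewrite /zsub /zcst /=; congr pair; ring. Qed.

(** Once [base k] is written as [v * base k.+1] and [x] acts as [z * z], both sides are
    [z]-coefficients of multiples of the same element; the recurrence becomes a polynomial identity
    with [INR k] as an indeterminate. *)
Ltac zext k :=
  rewrite /quad_part (baseS k) S_INR ?(zcstB _ 1) (zcstD _ 1) ?(zcstD _ (INR k));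
  move: (base k.+1) (INR k) => b K;
  rewrite ?zadd_2 ?zmul_x ?zmul_c ?zadd_2 ?zmul_x ?zmul_c ?zadd_2; cbn [zpow];
  apply: (f_equal (fun a : R * R => a.2 / 4)); ring.

(** Here begin the recurrences of the counts, with a factor [x] for each column used up and [y] for
    each row. *)
Lemma shrink_zS k e : shrink_z k.+1 e = shrink_z k e + x * shrink_top_z k.+1 e.
Proof. rewrite /shrink_z /shrink_top_z; zext k. Qed.

Lemma shrink_top_zS k e : shrink_top_z k.+1 e = shrink_top_z k e + shrink_z k.+1 (e + INR k).
Proof. rewrite /shrink_z /shrink_top_z; zext k. Qed.

Lemma slide_zS k e : slide_z k.+1 e = slide_z k e + x * slide_top_z k.+1 (e + INR k).
Proof. rewrite /slide_z /slide_top_z; zext k. Qed.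

Lemma slide_top_zS k e : slide_top_z k e = slide_z k e + y * (shrink_z k.+1 e + slide_top_z k.+1 e).
Proof. rewrite /slide_z /slide_top_z /shrink_z; zext k. Qed.

Lemma grow_top_zS k e :
  grow_top_z k e = x * grow_both_z k (e + INR k - 1) + y * (grow_top_z k.+1 e + slide_z k.+1 e).
Proof. rewrite /grow_top_z /grow_both_z /slide_z; zext k. Qed.

Lemma grow_both_zS k e :
  grow_both_z k e = grow_top_z k e + y * (grow_both_z k.+1 e + slide_top_z k.+1 e).
Proof. rewrite /grow_top_z /grow_both_z /slide_top_z; zext k. Qed.

Lemma start_zS k e :
  start_z k e = x * grow_both_z k (e + INR k - 1) + 2 * slide_z k e + shrink_z k e + y * start_z k.+1 e.
Proof. rewrite /start_z /start_c0 /start_c1 /grow_both_z /slide_z /shrink_z; zext k. Qed.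

Hypothesis discr_neq0 : discr <> 0.

Lemma zcstM a b : (a * b)%:z%zx = (a%:z * b%:z)%zx.
Proof. rewrite /zmul /zcst /=; congr pair; ring. Qed.

(** [base0] is the inverse of [v * q ^ 4]; this lemma and the next three clear more and more of that
    denominator, each [q] cancelling a [q'] against a [discr]. *)
Lemma v_base0 : (v * base0)%zx = ((/ discr ^ 4)%:z * q' ^ 4)%zx.
Proof.
have -> : (v * base0 = (v * (1%:z + z)) * ((/ ((1 - x) * discr ^ 4))%:z * q' ^ 4))%zx
  by rewrite /base0; cbn [zpow]; ring.
have -> : (v * (1%:z + z) = (1 - x)%:z)%zx
  by rewrite /zmul /zsub /zadd /zcst /zroot /=; congr pair; ring.
have -> : (/ discr ^ 4)%:z%zx = ((1 - x)%:z * (/ ((1 - x) * discr ^ 4))%:z)%zx.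
  by rewrite -zcstM; congr zcst; field.
ring.
Qed.

Lemma v_q_base0 : (v * q * base0)%zx = ((/ discr ^ 3)%:z * q' ^ 3)%zx.
Proof.
have -> : (v * q * base0 = q * (v * base0))%zx by ring.
rewrite v_base0.
have -> : (/ discr ^ 3)%:z%zx = (discr%:z * (/ discr ^ 4)%:z)%zx.
  by rewrite -zcstM; congr zcst; field.
rewrite -conj_discr; cbn [zpow]; ring.
Qed.

Lemma v_q2_base0 : (v * q ^ 2 * base0)%zx = ((/ discr ^ 2)%:z * q' ^ 2)%zx.
Proof.
have -> : (v * q ^ 2 * base0 = q * (v * q * base0))%zx by cbn [zpow]; ring.
rewrite v_q_base0.
have -> : (/ discr ^ 2)%:z%zx = (discr%:z * (/ discr ^ 3)%:z)%zx.
  by rewrite -zcstM; congr zcst; field.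
rewrite -conj_discr; cbn [zpow]; ring.
Qed.

Lemma v_q4_base0 : (v * q ^ 4 * base0)%zx = 1%:z%zx.
Proof.
have -> : (v * q ^ 4 * base0 = q * q * (v * q ^ 2 * base0))%zx by cbn [zpow]; ring.
rewrite v_q2_base0; transitivity (discr%:z * discr%:z * (/ discr ^ 2)%:z)%zx.
  by rewrite -conj_discr; cbn [zpow]; ring.
by rewrite -!zcstM; congr zcst; field.
Qed.

Lemma quad_part_0 G0 G1 G2 Ge e : quad_part G0 G1 G2 Ge 0 e = ((G0 + 4%:z * e%:z * Ge) * base0)%zx.2 / 4.
Proof.
rewrite /quad_part [INR 0]/= [base 0]/=; apply: (f_equal (fun a : R * R => a.2 / 4)); ring.
Qed.

(** This matches the counts, where at height 0 only [n = u = 0] contributes. *)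
Lemma shrink_z0 e : shrink_z 0 e = e.
Proof.
rewrite /shrink_z quad_part_0.
have -> : ((v * q ^ 4 + 4%:z * e%:z * (z * v * q ^ 4)) * base0 =
  (1%:z + 4%:z * e%:z * z) * (v * q ^ 4 * base0))%zx
  by ring.
rewrite v_q4_base0 /zmul /zadd /=; field.
Qed.

Lemma shrink_top_z0 e : shrink_top_z 0 e = 0.
Proof.
rewrite /shrink_top_z quad_part_0.
have -> : ((- v * q ^ 4 + 4%:z * e%:z * (v * q ^ 4)) * base0 =
  (4%:z * e%:z - 1%:z) * (v * q ^ 4 * base0))%zx
  by ring.
rewrite v_q4_base0 /zmul /zadd /=; field.
Qed.

(** The counts require 0 here; [slide_r] will make up for the difference. *)
Lemma slide_z0 e : slide_z 0 e = x * y / discr * ((-5 + 4 * (x + y) + (x - y) ^ 2) / discr + 2 * e).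
Proof.
rewrite /slide_z quad_part_0.
have -> : ((Y * z ^ 2 * v * ((-7)%:z + Y + 8%:z * z - z ^ 2) * q ^ 2 +
   4%:z * e%:z * (Y * z ^ 2 * v * q ^ 3)) * base0 =
   Y * z ^ 2 * ((-7)%:z + Y + 8%:z * z - z ^ 2 + 4%:z * e%:z * q) * (v * q ^ 2 * base0))%zx
  by cbn [zpow]; ring.
rewrite v_q2_base0 /zmul /zadd /=.
move: discr_neq0; rewrite /discr => ?; field. done.
Qed.

Lemma zcst_pow c n : (c%:z ^ n)%zx = (c ^ n, 0).
Proof. by elim: n => //= n ->; rewrite /zmul /zcst /=; congr pair; ring. Qed.

Lemma zroot_even n : (z ^ n.*2)%zx = (x ^ n, 0).
Proof. by elim: n => //= n ->; rewrite /zmul /zroot /=; congr pair; ring. Qed.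

Lemma zroot_odd n : (z ^ n.*2.+1)%zx = (0, x ^ n).
Proof. rewrite [LHS]/= zroot_even /zmul /zroot /=; congr pair; ring. Qed.

Definition zpowE := (zcst_pow, zroot_even 1, zroot_odd 1, zroot_even 2, zroot_odd 2, zroot_even 3).

Ltac zcompute := cbv [zmul zadd zsub zopp zcst zroot fst snd].

(* [(P0, P1)] and [(Q0, Q1)] are [start_c0] and [start_c1], and [(Ai, Bi)] is [q' ^ i]. *)
Definition start_z_num : R :=
  let c := 1 + x - y in
  let P0 := (1 - y) ^ 3 + x * (15 - 23 * y + 17 * y ^ 2 - 9 * y ^ 3)
            + x ^ 2 * (15 - 37 * y + 2 * y ^ 2) + x ^ 3 * (1 - y) in
  let P1 := - 6 + 10 * y - 2 * y ^ 2 - 2 * y ^ 3 - 20 * x * (1 - y) ^ 2 + x ^ 2 * (14 * y - 6) in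
  let Q0 := - (1 - y) ^ 2 - 3 * x * (1 + y) in
  let Q1 := 3 + 3 * y - 6 * y ^ 2 + x * (1 - 2 * y) in
  let A2 := c ^ 2 + 4 * x in let B2 := 4 * c in
  let A3 := c ^ 3 + 12 * c * x in let B3 := 6 * c ^ 2 + 8 * x in
  let A4 := c ^ 4 + 24 * c ^ 2 * x + 16 * x ^ 2 in let B4 := 8 * c ^ 3 + 32 * c * x in
  (P0 * B4 + P1 * A4 - P0 * A4 - x * P1 * B4)
  + discr * (Q0 * A3 + x * Q1 * B3 - x * (Q0 * B3 + Q1 * A3))
  + discr ^ 2 * x * ((1 - y) * B2 - A2 - (1 - y) * A2 + x * B2).

Lemma start_z_1 : start_z 1 0 = start_z_num / (4 * discr ^ 4).
Proof.
rewrite /start_z /quad_part /start_z_num.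
have b0 := baseS 0; rewrite [base 0]/= in b0.
set P := start_c0; set Q := start_c1.
(* Of the three factors [v], one turns [base 1] into [base0], one goes into clearing the denominator
   of [base0], and one stays outside. *)
have -> : ((v ^ 3 * P + (INR 1)%:z * (v ^ 3 * z * q * Q)
     + (INR 1)%:z * (INR 1)%:z * (v ^ 3 * z ^ 2 * q ^ 2 * (1%:z - Y - z))
     + 4%:z * 0%:z * (z * v ^ 4 * (v - Y) * q ^ 2)) * base 1 =
   v * (P * (v * (v * base 1)) + z * Q * (v * q * (v * base 1))
        + z ^ 2 * (1%:z - Y - z) * (v * q ^ 2 * (v * base 1))))%zx.
  by cbn [zpow INR]; ring.
rewrite -b0 v_base0 v_q_base0 v_q2_base0.
have -> : (/ discr ^ 3)%:z%zx = (discr%:z * (/ discr ^ 4)%:z)%zx.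
  by rewrite -zcstM; congr zcst; field.
have -> : (/ discr ^ 2)%:z%zx = (discr%:z * discr%:z * (/ discr ^ 4)%:z)%zx.
  by rewrite -!zcstM; congr zcst; field.
have -> a b : a / (4 * b) = / b * (a / 4) by rewrite /Rdiv Rinv_mult; ring.
set a4 := (q' ^ 4)%zx; set a3 := (q' ^ 3)%zx; set a2 := (q' ^ 2)%zx.
transitivity (/ discr ^ 4 * ((v * (P * a4 + z * Q * discr%:z * a3
    + z * z * (1%:z - Y - z) * discr%:z * discr%:z * a2))%zx.2 / 4)).
  by rewrite zmul_c; apply: (f_equal (fun a : R * R => a.2 / 4)); cbn [zpow]; ring.
congr (_ * (_ / _)).
have -> : a2 = ((1 + x - y) ^ 2 + 4 * x, 4 * (1 + x - y)).
  by rewrite /a2; cbn [zpow]; zcompute; congr pair; ring.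
have -> : a3 = ((1 + x - y) ^ 3 + 12 * (1 + x - y) * x, 6 * (1 + x - y) ^ 2 + 8 * x).
  by rewrite /a3; cbn [zpow]; zcompute; congr pair; ring.
have -> : a4 = ((1 + x - y) ^ 4 + 24 * (1 + x - y) ^ 2 * x + 16 * x ^ 2,
                8 * (1 + x - y) ^ 3 + 32 * (1 + x - y) * x).
  by rewrite /a4; cbn [zpow]; zcompute; congr pair; ring.
have -> : P = ((1 - y) ^ 3 + x * (15 - 23 * y + 17 * y ^ 2 - 9 * y ^ 3)
            + x ^ 2 * (15 - 37 * y + 2 * y ^ 2) + x ^ 3 * (1 - y),
    - 6 + 10 * y - 2 * y ^ 2 - 2 * y ^ 3 - 20 * x * (1 - y) ^ 2 + x ^ 2 * (14 * y - 6)).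
  by rewrite /P /start_c0 !zpowE; zcompute; congr pair; ring.
have -> : Q = (- (1 - y) ^ 2 - 3 * x * (1 + y), 3 + 3 * y - 6 * y ^ 2 + x * (1 - 2 * y)).
  by rewrite /Q /start_c1 !zpowE; zcompute; congr pair; ring.
by zcompute; ring.
Qed.
End QuadraticExtension.

(** * Correction terms from the root of the kernel *)

Section KernelRoot.
Variables p w : R.
Let x := p * (1 - w).
Let y := w * (1 - p).
Let s := 1 - p - w.
Hypothesis p_neq1 : 1 - p <> 0.
Hypothesis s_neq0 : s <> 0.

(* [1 / (1 - p)] is the root [r] of [y r ^ 2 - (1 + y - x) r + 1] that is close to 1. *)
Definition root_part (c0 c1 c2 ce : R) (k : nat) (e : R) : R :=
  (c0 + INR k * c1 + INR k * INR k * c2 + e * ce) * (/ (1 - p)) ^ k.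

(** This and the following forms solve the same recurrences with the [shrink] terms removed, and are
    scaled so that the corrected [slide] vanishes at height 0. *)
Definition slide_r := root_part
  (p * w * (1 - p) * (1 - w) * (5 - 4 * w - 4 * p - w^2 + 10 * p * w - p^2) / s^4)
  (p^2 * w * (1 - p) * (1 - w) * (1 - 2 * w - p + w^2 - p * w) / s^4)
  (- (p^2 * w * (1 - p) * (1 - w)^2) / s^3)
  (- 2 * p * w * (1 - p) * (1 - w) / s^2).

Definition slide_top_r := root_part
  (p * w * (1 - p) * (5 - 4 * w - 4 * p - w^2 + 10 * p * w - p^2 - 2 * p * w^2) / s^4)
  (p^2 * w * (1 - p) * (1 - w) * (1 - 3 * w - p) / s^4)
  (- (p^2 * w * (1 - p) * (1 - w)) / s^3)
  (- 2 * p * w * (1 - p) / s^2).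

Definition grow_both_r := root_part
  (p * w^2 * (1 - p) * (10 - 18 * w - 14 * p + 6 * w^2 + 12 * p * w - 2 * p^2 + 2 * w^3 - 2 * p * w^2
     + 2 * p^2 * w + 6 * p^3 + 4 * p * w^3 - 16 * p^2 * w^2 + 4 * p^3 * w) / s^6)
  (- 6 * p^2 * w^2 * (1 - p) * (1 - w) * (1 + w - p) / s^5)
  (- 2 * p^2 * w^2 * (1 - p) * (1 - w) / s^4)
  (- 4 * p * w^2 * (1 - p) / s^3).

Definition grow_top_r := root_part
  (p * w^2 * (1 - p) * (5 - 14 * w + 12 * w^2 - 14 * p^2 - 2 * w^3 + 14 * p^2 * w + 8 * p^3 - w^4
     - 12 * p^2 * w^2 + p^4 + 12 * p^2 * w^3 - 12 * p^3 * w^2) / s^6)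
  (p^2 * w^2 * (1 - p) * (1 - w) * (- 5 + 4 * w + 4 * p + w^2 - 10 * p * w + p^2) / s^5)
  (p^2 * w^2 * (1 - p) * (1 - w) * (- 1 + w - p) / s^4)
  (2 * p * w^2 * (1 - p) * (w - 1 - p) / s^3).

Definition start_r := root_part
  (p * w * (1 - p)^2 * (1 - w) * (10 - 18 * w - 18 * p + 6 * w^2 + 40 * p * w + 6 * p^2 + 2 * w^3
     - 34 * p * w^2 - 22 * p^2 * w + 2 * p^3 + 12 * p * w^3 - 12 * p^2 * w^2) / s^6)
  (p^2 * w * (1 - p)^2 * (1 - w) * (2 - 12 * w - 2 * p + 10 * w^2 - 2 * p * w) / s^5)
  (- 2 * p^2 * w * (1 - p)^2 * (1 - w)^2 / s^4)
  (- 4 * p * w * (1 - p)^2 * (1 - w) / s^3).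

Ltac root_field k :=
  rewrite /root_part S_INR /=; move: ((/ (1 - p)) ^ k) (INR k) => r K; rewrite /x /y /s;
  field; repeat split; assumption.

Lemma slide_rS k e : slide_r k.+1 e = slide_r k e + x * slide_top_r k.+1 (e + INR k).
Proof. rewrite /slide_r /slide_top_r; root_field k. Qed.

Lemma slide_top_rS k e : slide_top_r k e = slide_r k e + y * slide_top_r k.+1 e.
Proof. rewrite /slide_r /slide_top_r; root_field k. Qed.

Lemma grow_top_rS k e :
  grow_top_r k e = x * grow_both_r k (e + INR k - 1) + y * (grow_top_r k.+1 e + slide_r k.+1 e).
Proof. rewrite /grow_top_r /grow_both_r /slide_r; root_field k. Qed.

Lemma grow_both_rS k e :
  grow_both_r k e = grow_top_r k e + y * (grow_both_r k.+1 e + slide_top_r k.+1 e).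
Proof. rewrite /grow_top_r /grow_both_r /slide_top_r; root_field k. Qed.

Lemma start_rS k e :
  start_r k e = x * grow_both_r k (e + INR k - 1) + 2 * slide_r k e + y * start_r k.+1 e.
Proof. rewrite /start_r /grow_both_r /slide_r; root_field k. Qed.

Lemma discr_s : discr x y = s ^ 2.
Proof. rewrite /discr /x /y /s; ring. Qed.

Hypothesis x_neq1 : 1 - x <> 0.

Lemma discr_neq0 : discr x y <> 0.
Proof. by rewrite discr_s; apply: pow_nonzero. Qed.

Lemma slide_zr_0 e : slide_z x y 0 e + slide_r 0 e = 0.
Proof.
rewrite (slide_z0 x_neq1 discr_neq0) discr_s /slide_r /root_part /x /y /s /=.
by field; exact: s_neq0.
Qed.

Definition start_r_num := (1 - p) * (1 - w) * (
  (10 - 18 * w - 18 * p + 6 * w^2 + 40 * p * w + 6 * p^2 + 2 * w^3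
     - 34 * p * w^2 - 22 * p^2 * w + 2 * p^3 + 12 * p * w^3 - 12 * p^2 * w^2)
  + s * (p * (2 - 12 * w - 2 * p + 10 * w^2 - 2 * p * w))
  - 2 * s^2 * p * (1 - w)).

Lemma start_r_1 : start_r 1 0 = p * w * start_r_num / s ^ 6.
Proof. by rewrite /start_r /root_part /start_r_num /=; field; split. Qed.

(** In terms of [p] and [w] the square root of the discriminant is the polynomial [s], so the
    comparison with the announced formula is a polynomial identity. *)
Lemma start_num : let u := y - x - 1 in
  start_z_num x y + 4 * p * w * start_r_num * s ^ 2 =
  4 * x * y * (8 * x * (4 * x * (x ^ 2 + 6 * x - 1) + 4 * x * (5 * x + 11) * u
                        + (6 * x ^ 2 + 29 * x + 17) * u ^ 2)
    + u ^ 3 * (40 * x * (2 * x + 1) + 2 * (x ^ 2 + 11 * x - 8) * u + u ^ 2 * (y + x - 1))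
    + 4 * (4 - 3 * (x + y) - (x - y) ^ 2) * s ^ 3).
Proof. by rewrite /start_z_num discr_s /start_r_num /x /y /s /=; ring. Qed.
End KernelRoot.

(** * Partial sums by total degree *)

Section HomogeneousSums.
Variables x y : R.
Implicit Types F G : nat -> nat -> nat.

Definition hom F (N : nat) : R := sum_f_R0 (fun m => INR (F m (Nat.sub N m)) * x ^ m * y ^ (Nat.sub N m)) N.

(** The degrees below [N]: [psum F 0] is empty, and multiplying by [x] or [y] costs exactly one unit
    of [N]. *)
Fixpoint psum F (N : nat) : R := if N is N'.+1 then psum F N' + hom F N' else 0.

(** [shx] and [shy] act on coefficients as multiplication by [x] and by [y] does on generating
    functions. *)
Definition shx F m u := if m is m'.+1 then F m' u else 0%nat.
Definition shy F m u := if u is u'.+1 then F m u' else 0%nat.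

Lemma psumS F N : psum F N.+1 = psum F N + hom F N.
Proof. by []. Qed.

Lemma psum_ext F G N : (forall m u, F m u = G m u) -> psum F N = psum G N.
Proof.
move=> FG; elim: N => //= N ->; congr (_ + _); apply: sum_eq => m _; by rewrite FG.
Qed.

Lemma psum_add F G N : psum (fun m u => addn (F m u) (G m u)) N = psum F N + psum G N.
Proof.
elim: N => [|N /= ->]; first by rewrite /=; ring.
suff -> : hom (fun m u => addn (F m u) (G m u)) N = hom F N + hom G N by ring.
rewrite /hom -sum_plus; apply: sum_eq => m _; rewrite plus_INR; ring.
Qed.

Lemma psum_shx F N : psum (shx F) N.+1 = x * psum F N.
Proof.
elim: N => [|N IHN]; first by rewrite /= /hom /=; ring.
rewrite psumS IHN psumS Rmult_plus_distr_l; congr (_ + _).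
rewrite /hom decomp_sum /=; last by lia.
rewrite Rmult_0_l Rmult_0_l Rplus_0_l scal_sum; apply: sum_eq => m _; ring.
Qed.

Lemma psum_shy F N : psum (shy F) N.+1 = y * psum F N.
Proof.
elim: N => [|N IHN]; first by rewrite /= /hom /=; ring.
rewrite psumS IHN psumS Rmult_plus_distr_l; congr (_ + _).
rewrite /hom tech5 Nat.sub_diag /= Rmult_0_l Rmult_0_l Rplus_0_r scal_sum; apply: sum_eq => m mN.
rewrite -/(Nat.sub N.+1 m) Nat.sub_succ_l //=; ring.
Qed.

Lemma psum_cst e N : psum (fun m u => if (eqn m 0) && (eqn u 0) then e else 0%nat) N.+1 = INR e.
Proof.
elim: N => [|N IHN]; first by rewrite /= /hom /=; ring.
rewrite psumS IHN /hom decomp_sum /=; last by lia.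
rewrite (sum_eq _ (fun=> 0)); last by move=> m _; rewrite /=; ring.
rewrite sum_cte; ring.
Qed.
End HomogeneousSums.

(** * Contraction of the homogeneous system *)

Section ErrorDecay.
Variables x y : R.
Hypothesis hx : Rabs x <= / 64.
Hypothesis hy : Rabs y <= / 64.

(* The weight is chosen so that adding at most [k] to [e] costs a factor 2 only ([growth_shift]). *)
Definition growth (k e : nat) : R := INR e * 2 ^ k + 4 ^ k.

Lemma pow2_ge1 k : 1 <= 2 ^ k.
Proof. apply: pow_R1_Rle; lra. Qed.

Lemma pow4E k : 4 ^ k = 2 ^ k * 2 ^ k.
Proof. rewrite -Rpow_mult_distr; congr (_ ^ _); ring. Qed.

Lemma INR_lt_pow2 k : INR k + 1 <= 2 ^ k.
Proof. elim: k => [|k IHk]; first by rewrite /=; lra. have := pow2_ge1 k; rewrite S_INR /=; lra. Qed.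

Lemma growth_gt0 k e : 0 < growth k e.
Proof.
rewrite /growth; have := pos_INR e; have := pow_lt 2 k; have := pow_lt 4 k => h4 h2 he.
have := Rmult_le_pos _ _ he (Rlt_le _ _ (h2 ltac:(lra))); have := h4 ltac:(lra); lra.
Qed.

Lemma growth_kS k e : 2 * growth k e <= growth k.+1 e <= 4 * growth k e.
Proof.
rewrite /growth /=; have he := pos_INR e; have h2 := pow2_ge1 k; have h4 := pow_lt 4 k ltac:(lra).
have : 0 <= INR e * 2 ^ k by apply: Rmult_le_pos; lra.
split; lra.
Qed.

Lemma growth_shift k e i : (i <= k)%coq_nat -> growth k (addn e i) <= 2 * growth k e.
Proof.
move=> ik; rewrite /growth plus_INR pow4E; have he := pos_INR e; have h2 := pow2_ge1 k.
have hi : INR i <= 2 ^ k by have := le_INR _ _ ik; have := INR_lt_pow2 k; lra.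
have : 0 <= INR e * 2 ^ k by apply: Rmult_le_pos; lra.
have : INR i * 2 ^ k <= 2 ^ k * 2 ^ k by apply: Rmult_le_compat_r; lra.
lra.
Qed.

(** In this order they stand for the errors of [shrink], [shrink_top], [slide], [slide_top], [grow],
    [grow_top], [grow_both] and [start]. *)
Variables u3 x3 u2 v2 u1 j1 h1 l1 : nat -> nat -> nat -> R.
Hypothesis u3_0 : forall N e, u3 N.+1 0 e = 0.
Hypothesis u3_S : forall N k e, u3 N.+1 k.+1 e = u3 N.+1 k e + x * x3 N k.+1 e.
Hypothesis x3_0 : forall N e, x3 N 0 e = 0.
Hypothesis x3_S : forall N k e, x3 N k.+1 e = x3 N k e + u3 N k.+1 (addn e k).
Hypothesis u2_0 : forall N e, u2 N.+1 0 e = 0.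
Hypothesis u2_S : forall N k e, u2 N.+1 k.+1 e = u2 N.+1 k e + x * v2 N k.+1 (addn e k).
Hypothesis v2_S : forall N k e, v2 N.+1 k e = u2 N.+1 k e + y * (u3 N k.+1 e + v2 N k.+1 e).
Hypothesis u1_S : forall N k e, u1 N.+1 k.+1 e = x * h1 N k.+1 (addn e k).
Hypothesis j1_S : forall N k e, j1 N.+1 k.+1 e = u1 N.+1 k.+1 e + y * (j1 N k.+2 e + u2 N k.+2 e).
Hypothesis h1_S : forall N k e, h1 N.+1 k.+1 e = j1 N.+1 k.+1 e + y * (h1 N k.+2 e + v2 N k.+2 e).
Hypothesis l1_S : forall N k e, l1 N.+1 k.+1 e =
  u1 N.+1 k.+1 e + 2 * u2 N.+1 k.+1 e + u3 N.+1 k.+1 e + y * l1 N k.+2 e.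

(** The last three are controlled at positive heights only, where the truncated [k.-1] of [grow_S]
    agrees with the real [k - 1] of the closed forms. *)
Definition decays B N := forall k e,
  [/\ Rabs (u3 N k e) <= B * growth k e, Rabs (x3 N k e) <= B * growth k e,
      Rabs (u2 N k e) <= B * growth k e & Rabs (v2 N k e) <= B * growth k e] /\
  [/\ Rabs (j1 N k.+1 e) <= B * growth k.+1 e,
      Rabs (h1 N k.+1 e) <= B * growth k.+1 e & Rabs (l1 N k.+1 e) <= B * growth k.+1 e].

Lemma Rabs_mul_le a b c d : Rabs a <= c -> Rabs b <= d -> Rabs (a * b) <= c * d.
Proof. by move=> ac bd; rewrite Rabs_mult; apply: Rmult_le_compat => //; apply: Rabs_pos. Qed.

Lemma Rabs_add_le a b c d : Rabs a <= c -> Rabs b <= d -> Rabs (a + b) <= c + d.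
Proof. by move=> ac bd; apply: Rle_trans (Rabs_triang _ _) _; lra. Qed.

(** The system is triangular: level [N] enters level [N.+1] only with a factor [x] or [y], and
    everything else comes from a smaller [k] or from a quantity bounded before. *)
Lemma decays_step B N : 0 <= B -> decays (2 * B) N -> decays B N.+1.
Proof.
move=> B0 dN.
have g0 k e := Rlt_le _ _ (growth_gt0 k e).
have Bg k e : 0 <= B * growth k e by apply: Rmult_le_pos.
have Bk k e : 2 * (B * growth k e) <= B * growth k.+1 e <= 4 * (B * growth k e).
  have [h1' h2'] := growth_kS k e.
  have := Rmult_le_compat_l _ _ _ B0 h1'; have := Rmult_le_compat_l _ _ _ B0 h2'; lra.
have Bi k e i : (i <= k)%coq_nat -> B * growth k (addn e i) <= 2 * (B * growth k e).
  by move=> ik; have := Rmult_le_compat_l _ _ _ B0 (growth_shift e ik); lra.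
(* The constant reproduces itself: [growth] at least doubles with [k], so the induction hypothesis
   gives 1/32, and [/ 64] times the bound [2 * B] gives another 1/32. The constants 1/4 and 1/8
   below arise likewise. *)
have du3 k e : Rabs (u3 N.+1 k e) <= / 16 * (B * growth k e).
  elim: k => [|k IHk]; first by rewrite u3_0 Rabs_R0; have := Bg 0%nat e; lra.
  rewrite u3_S; have [[_ h _ _] _] := dN k.+1 e.
  have := Rabs_add_le IHk (Rabs_mul_le hx h); have := Bk k e; lra.
have dx3 k e : Rabs (x3 N.+1 k e) <= / 4 * (B * growth k e).
  elim: k => [|k IHk]; first by rewrite x3_0 Rabs_R0; have := Bg 0%nat e; lra.
  rewrite x3_S; have := Rabs_add_le IHk (du3 k.+1 (addn e k)).
  have := Bk k e; have := Bi k.+1 e k (Nat.le_succ_diag_r k); lra.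
have du2 k e : Rabs (u2 N.+1 k e) <= / 8 * (B * growth k e).
  elim: k => [|k IHk]; first by rewrite u2_0 Rabs_R0; have := Bg 0%nat e; lra.
  rewrite u2_S; have [[_ _ _ h] _] := dN k.+1 (addn e k).
  have := Rabs_add_le IHk (Rabs_mul_le hx h).
  have := Bk k e; have := Bi k.+1 e k (Nat.le_succ_diag_r k); lra.
have dv2 k e : Rabs (v2 N.+1 k e) <= B * growth k e.
  rewrite v2_S; have [[h3 _ _ h] _] := dN k.+1 e.
  have := Rabs_add_le (du2 k e) (Rabs_mul_le hy (Rabs_add_le h3 h)); have := Bk k e; have := Bg k e; lra.
have du1 k e : Rabs (u1 N.+1 k.+1 e) <= / 16 * (B * growth k.+1 e).
  rewrite u1_S; have [_ [_ h _]] := dN k (addn e k).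
  have := Rabs_mul_le hx h; have := Bi k.+1 e k (Nat.le_succ_diag_r k); lra.
have dj1 k e : Rabs (j1 N.+1 k.+1 e) <= / 2 * (B * growth k.+1 e).
  rewrite j1_S; have [[_ _ h _] _] := dN k.+2 e; have [_ [h' _ _]] := dN k.+1 e.
  have := Rabs_add_le (du1 k e) (Rabs_mul_le hy (Rabs_add_le h' h));
    have := Bk k.+1 e; have := Bg k.+1 e; lra.
have dh1 k e : Rabs (h1 N.+1 k.+1 e) <= B * growth k.+1 e.
  rewrite h1_S; have [[_ _ _ h] _] := dN k.+2 e; have [_ [_ h' _]] := dN k.+1 e.
  have := Rabs_add_le (dj1 k e) (Rabs_mul_le hy (Rabs_add_le h' h));
    have := Bk k.+1 e; have := Bg k.+1 e; lra.
have dl1 k e : Rabs (l1 N.+1 k.+1 e) <= B * growth k.+1 e.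
  rewrite l1_S; have [_ [_ _ h]] := dN k.+1 e.
  have h2 : Rabs 2 <= 2 by rewrite Rabs_right; lra.
  have := Rabs_add_le (Rabs_add_le (Rabs_add_le (du1 k e) (Rabs_mul_le h2 (du2 k.+1 e)))
    (du3 k.+1 e)) (Rabs_mul_le hy h).
  have := Bk k.+1 e; have := Bg k.+1 e; lra.
move=> k e; split; split=> //.
- by have := du3 k e; have := Bg k e; lra.
- by have := dx3 k e; have := Bg k e; lra.
- by have := du2 k e; have := Bg k e; lra.
- by have := dj1 k e; have := Bg k.+1 e; lra.
Qed.

Lemma error_tends_to_0 B : 0 <= B -> decays B 0 -> is_lim_seq (fun N => l1 N 1 0) 0.
Proof.
move=> B0 d0.
have dN N : decays (B * (/ 2) ^ N) N.
  elim: N => [|N IHN]; first by rewrite /= Rmult_1_r.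
  have p := pow_lt (/ 2) N.+1 ltac:(lra).
  apply: decays_step; first by apply: Rmult_le_pos => //; lra.
  have -> : 2 * (B * (/ 2) ^ N.+1) = B * (/ 2) ^ N by rewrite /=; field.
  exact: IHN.
have lim0 c : is_lim_seq (fun N => c * (/ 2) ^ N) 0.
  have -> : (0 : Rbar) = Rbar_mult c 0 by rewrite /= Rmult_0_r.
  apply: is_lim_seq_scal_l; apply: is_lim_seq_geom; rewrite Rabs_right; lra.
apply: (is_lim_seq_le_le (fun N => - (B * growth 1 0) * (/ 2) ^ N) _
  (fun N => (B * growth 1 0) * (/ 2) ^ N)) => // N.
have [_ [_ _ h]] := dN N 0%nat 0%nat.
have := Rle_abs (l1 N 1 0); have := Rle_abs (- l1 N 1 0); rewrite Rabs_Ropp; lra.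
Qed.
End ErrorDecay.

(** * Exponential bounds for the closed forms *)

Definition bounded (F : nat -> R -> R) :=
  exists2 B, 0 <= B & forall k e, Rabs (F k (INR e)) <= B * growth k e.

Lemma INR_sqr_le_pow2 k : INR k * INR k <= 2 * 2 ^ k.
Proof.
elim: k => [|k IHk]; first by rewrite /=; lra.
have := INR_lt_pow2 k; have := pow2_ge1 k; have := pos_INR k; rewrite S_INR /=; nra.
Qed.

Lemma bounded_add F G : bounded F -> bounded G -> bounded (fun k e => F k e + G k e).
Proof.
move=> [B B0 FB] [C C0 GC]; exists (B + C); first lra.
by move=> k e; rewrite Rmult_plus_distr_r; apply: Rabs_add_le.
Qed.

(** Both [k] and [k ^ 2] are at most a multiple of [2 ^ k]; the other factor [2 ^ k] bounds [g],
    which together gives the two terms of [growth]. *)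
Lemma bounded_quadratic c0 c1 c2 ce (g : nat -> R) C : (forall k, Rabs (g k) <= C * 2 ^ k) ->
  bounded (fun k e => (c0 + INR k * c1 + INR k * INR k * c2 + e * ce) * g k).
Proof.
move=> gC; have C0 : 0 <= C by have := gC 0%nat; have := Rabs_pos (g 0%nat); rewrite /=; lra.
have [p0 p1 p2 pe] : [/\ 0 <= Rabs c0, 0 <= Rabs c1, 0 <= Rabs c2 & 0 <= Rabs ce]
  by split; apply: Rabs_pos.
set B := Rabs c0 + Rabs c1 + 2 * Rabs c2 + Rabs ce.
exists (B * C); first by rewrite /B; apply: Rmult_le_pos; lra.
move=> k e; have he := pos_INR e; have hk := pos_INR k.
have h1 := INR_lt_pow2 k; have h2 := INR_sqr_le_pow2 k; have h3 := pow2_ge1 k.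
have b1 : Rabs (INR k * c1) <= 2 ^ k * Rabs c1.
  by apply: Rabs_mul_le (Rle_refl _); rewrite Rabs_right; lra.
have b2 : Rabs (INR k * INR k * c2) <= 2 * 2 ^ k * Rabs c2.
  by apply: Rabs_mul_le (Rle_refl _); rewrite Rabs_right; have := Rmult_le_pos _ _ hk hk; lra.
have be : Rabs (INR e * ce) <= INR e * Rabs ce.
  by apply: Rabs_mul_le (Rle_refl _); rewrite Rabs_right; lra.
have b0 : Rabs c0 <= 2 ^ k * Rabs c0 by nra.
have bb : Rabs (c0 + INR k * c1 + INR k * INR k * c2 + INR e * ce) <= B * (2 ^ k + INR e).
  have := Rabs_add_le (Rabs_add_le (Rabs_add_le b0 b1) b2) be.
  have : 0 <= (Rabs c0 + Rabs c1 + 2 * Rabs c2) * INR e by apply: Rmult_le_pos; lra.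
  have : 0 <= Rabs ce * 2 ^ k by apply: Rmult_le_pos; lra.
  rewrite /B; lra.
apply: Rle_trans (Rabs_mul_le bb (gC k)) _; rewrite /growth pow4E; right; ring.
Qed.

Section Bounds.
Variables x y : R.
Hypothesis hx : Rabs x <= / 64.

Lemma base_bound : exists C, forall k, Rabs (base x y k).1 <= C * 2 ^ k /\ Rabs (base x y k).2 <= C * 2 ^ k.
Proof.
(* The weight 1/2 on the second coordinate keeps the factor per step below 2: the first coordinate
   enters with at most 10/9 times 3/2. *)
pose nrm (b : R * R) := Rabs b.1 + / 2 * Rabs b.2.
have x64 := Rabs_def2 x _ (Rle_lt_trans _ _ (/ 32) hx ltac:(lra)).
have step k : nrm (base x y k.+1) <= 2 * nrm (base x y k).
  have -> : base x y k.+1 =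
    (/ (1 - x) * ((base x y k).1 + x * (base x y k).2), / (1 - x) * ((base x y k).1 + (base x y k).2)).
    rewrite /= /zmul /zadd /zcst /zroot /=; congr pair; ring.
  case: (base x y k) => a b; rewrite /nrm /=.
  have i1 : Rabs (/ (1 - x)) <= 10 / 9.
    rewrite Rabs_right; last by apply: Rle_ge; apply: Rlt_le; apply: Rinv_0_lt_compat; lra.
    by rewrite -(Rinv_inv (10 / 9)); apply: Rinv_le_contravar; lra.
  have i2 : Rabs (a + x * b) <= Rabs a + / 64 * Rabs b.
    by apply: Rabs_add_le; [lra | apply: Rabs_mul_le; lra].
  have i3 : Rabs (a + b) <= Rabs a + Rabs b by apply: Rabs_triang.
  have := Rabs_mul_le i1 i2; have := Rabs_mul_le i1 i3; have := Rabs_pos a; have := Rabs_pos b; lra.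
have nk k : nrm (base x y k) <= nrm (base x y 0) * 2 ^ k.
  by elim: k => [|k IHk]; [rewrite /= Rmult_1_r; lra | have := step k; rewrite [2 ^ _]/=; lra].
exists (2 * nrm (base x y 0)) => k; have := nk k; rewrite /nrm.
have := Rabs_pos (base x y k).1; have := Rabs_pos (base x y k).2; lra.
Qed.

Lemma quad_part_bounded G0 G1 G2 Ge : bounded (quad_part x y G0 G1 G2 Ge).
Proof.
have [C bC] := base_bound.
(* The [z]-coefficient of a product is first times second plus second times first coordinate. *)
pose P (c : R * R -> R) (g : nat -> R) := fun k e =>
  (c G0 / 4 + INR k * (c G1 / 4) + INR k * INR k * (c G2 / 4) + e * c Ge) * g k.
have [B B0 hB] : bounded (fun k e =>
    P fst (fun k => (base x y k).2) k e + P snd (fun k => (base x y k).1) k e).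
  by apply: bounded_add; apply: (@bounded_quadratic _ _ _ _ _ C) => k; case: (bC k).
exists B => // k e; move: (hB k e); congr (Rabs _ <= _).
rewrite /P /quad_part /zmul /zadd /zcst /=; field.
Qed.

Lemma root_part_bounded p c0 c1 c2 ce : Rabs p <= / 2 -> bounded (root_part p c0 c1 c2 ce).
Proof.
move=> hp; apply: (@bounded_quadratic _ _ _ _ _ 1) => k; rewrite Rmult_1_l -RPow_abs.
have p2 := Rabs_def2 p _ (Rle_lt_trans _ _ (3 / 4) hp ltac:(lra)).
have hp' : p <= / 2 by have := Rle_abs p; lra.
apply: pow_incr; split; first exact: Rabs_pos.
rewrite Rabs_right; last by apply: Rle_ge; apply: Rlt_le; apply: Rinv_0_lt_compat; lra.
by rewrite -(Rinv_inv 2); apply: Rinv_le_contravar; lra.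
Qed.
End Bounds.

Lemma INR_addn a b : INR (addn a b) = INR a + INR b.
Proof. exact: plus_INR. Qed.

(** * Convergence of the series to the closed forms *)

Section Convergence.
Variables p w : R.
Hypothesis hp : Rabs p <= / 8.
Hypothesis hw : Rabs w <= / 8.
Let x := p * (1 - w).
Let y := w * (1 - p).
Hypothesis hx : Rabs x <= / 64.
Hypothesis hy : Rabs y <= / 64.

Lemma p_neq1 : 1 - p <> 0.
Proof. have := Rle_abs p; lra. Qed.

Lemma pw_neq1 : 1 - p - w <> 0.
Proof. have := Rle_abs p; have := Rle_abs w; lra. Qed.

Lemma x_neq1 : 1 - x <> 0.
Proof. have := Rle_abs x; lra. Qed.

Definition slide_lim k e := slide_z x y k e + slide_r p w k e.
Definition slide_top_lim k e := slide_top_z x y k e + slide_top_r p w k e.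
Definition grow_top_lim k e := grow_top_z x y k e + grow_top_r p w k e.
Definition grow_both_lim k e := grow_both_z x y k e + grow_both_r p w k e.
Definition start_lim k e := start_z x y k e + start_r p w k e.

Definition dev (lim : nat -> R -> R) (F : nat -> nat -> nat -> nat -> nat) (N k e : nat) : R :=
  lim k (INR e) - psum x y (fun n u => F n u k e) N.

Lemma bounded_lim : exists2 B, 0 <= B &
  decays (dev (shrink_z x y) shrink) (dev (shrink_top_z x y) shrink_top)
    (dev slide_lim slide) (dev slide_top_lim slide_top)
    (dev grow_top_lim grow_top) (dev grow_both_lim grow_both) (dev start_lim start) B 0.
Proof.
have p2 : Rabs p <= / 2 by lra.
have b1 : bounded (shrink_z x y) := quad_part_bounded _ hx _ _ _ _.
have b2 : bounded (shrink_top_z x y) := quad_part_bounded _ hx _ _ _ _.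
have b3 : bounded slide_lim :=
  bounded_add (quad_part_bounded _ hx _ _ _ _) (root_part_bounded _ _ _ _ p2).
have b4 : bounded slide_top_lim :=
  bounded_add (quad_part_bounded _ hx _ _ _ _) (root_part_bounded _ _ _ _ p2).
have b5 : bounded grow_top_lim :=
  bounded_add (quad_part_bounded _ hx _ _ _ _) (root_part_bounded _ _ _ _ p2).
have b6 : bounded grow_both_lim :=
  bounded_add (quad_part_bounded _ hx _ _ _ _) (root_part_bounded _ _ _ _ p2).
have b7 : bounded start_lim :=
  bounded_add (quad_part_bounded _ hx _ _ _ _) (root_part_bounded _ _ _ _ p2).
move: b1 b2 b3 b4 b5 b6 b7 => [B1 q1 h1] [B2 q2 h2] [B3 q3 h3] [B4 q4 h4] [B5 q5 h5] [B6 q6 h6] [B7 q7 h7].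
exists (B1 + B2 + B3 + B4 + B5 + B6 + B7); first lra.
have mono B k e t : Rabs t <= B * growth k e -> B <= B1 + B2 + B3 + B4 + B5 + B6 + B7 ->
    Rabs t <= (B1 + B2 + B3 + B4 + B5 + B6 + B7) * growth k e.
  move=> tB BB; apply: Rle_trans tB _; apply: Rmult_le_compat_r => //.
  exact: Rlt_le (growth_gt0 k e).
by move=> k e; rewrite /dev /= !Rminus_0_r; split; split;
  [apply: (mono _ _ _ _ (h1 _ _)) | apply: (mono _ _ _ _ (h2 _ _)) | apply: (mono _ _ _ _ (h3 _ _))
  | apply: (mono _ _ _ _ (h4 _ _)) | apply: (mono _ _ _ _ (h5 _ _)) | apply: (mono _ _ _ _ (h6 _ _))
  | apply: (mono _ _ _ _ (h7 _ _))]; lra.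
Qed.

Lemma start_cvg : is_lim_seq (psum x y (fun n s => start n s 1 0)) (start_lim 1 0).
Proof.
have [B B0 dB] := bounded_lim.
have hd : discr x y <> 0 by rewrite discr_s; apply: pow_nonzero; apply: pw_neq1.
have x1 := x_neq1; have p1 := p_neq1; have s1 := pw_neq1.
(* [grow] has been given no closed form of its own; its limit is read off [grow_S]. *)
pose start_grow k e := x * grow_both_lim k (e + INR k - 1).
suff : is_lim_seq (fun N => dev start_lim start N 1 0) 0.
  move=> h; apply: (is_lim_seq_ext (fun N => start_lim 1 0 - dev start_lim start N 1 0)).
    by move=> N; rewrite /dev /=; ring.
  rewrite -[X in is_lim_seq _ (Finite X)]Rminus_0_r.
  by apply: is_lim_seq_minus'; first exact: is_lim_seq_const.
apply: (@error_tends_to_0 x y hx hy _ _ _ _ (dev start_grow grow) _ _ _ _ _ _ _ _ _ _ _ _ _ _ B B0 dB);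
  rewrite /dev => N.
- move=> e; rewrite shrink_z0 //.
  rewrite (@psum_ext _ _ _ (fun m u => if (eqn m 0) && (eqn u 0) then e else 0%nat)) ?psum_cst; first ring.
  by case=> [|n] u; rewrite ?shrink_k0 // shrink_0.
- move=> k e; rewrite shrink_zS //.
  rewrite (@psum_ext _ _ (fun n u => shrink n u k.+1 e)
    (fun n u => addn (shrink n u k e) (shx (fun n u => shrink_top n u k.+1 e) n u))).
    by rewrite psum_add psum_shx /x /y; ring.
  by case=> [|n] u; rewrite ?shrink_kS //= !shrink_0 addn0.
- move=> e; rewrite shrink_top_z0 //.
  have -> : psum x y (fun n u => shrink_top n u 0 e) N = 0.
    elim: N => //= N ->; rewrite /hom (sum_eq _ (fun=> 0)); first by rewrite sum_cte; ring.
    by move=> m _; rewrite shrink_top_k0 /=; ring.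
  ring.
- move=> k e; rewrite shrink_top_zS // INR_addn.
  rewrite (@psum_ext _ _ (fun n u => shrink_top n u k.+1 e)
    (fun n u => addn (shrink_top n u k e) (shrink n u k.+1 (addn e k)))).
    by rewrite psum_add; ring.
  by move=> n u; rewrite shrink_top_kS.
- move=> e; rewrite /slide_lim slide_zr_0 //.
  rewrite (@psum_ext _ _ _ (fun m u => if (eqn m 0) && (eqn u 0) then 0%nat else 0%nat)) ?psum_cst; first by rewrite /=; ring.
  by case=> [|n] u; rewrite ?slide_k0 ?slide_0 //=; case: ifP.
- move=> k e; rewrite /slide_lim slide_zS // slide_rS //.
  rewrite (@psum_ext _ _ (fun n u => slide n u k.+1 e)
    (fun n u => addn (slide n u k e) (shx (fun n u => slide_top n u k.+1 (addn e k)) n u))).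
    by rewrite psum_add psum_shx INR_addn /slide_top_lim /x /y; ring.
  by case=> [|n] u; rewrite ?slide_kS //= !slide_0 addn0.
- move=> k e; rewrite /slide_top_lim slide_top_zS // slide_top_rS //.
  rewrite (@psum_ext _ _ (fun n u => slide_top n u k e)
    (fun n u => addn (slide n u k e) (shy (fun n u => addn (shrink n u k.+1 e) (slide_top n u k.+1 e)) n u))).
    by rewrite psum_add psum_shy psum_add /slide_lim /slide_top_lim /x /y; ring.
  by move=> n [|u]; rewrite ?slide_top_uS ?slide_top_u0 //= addn0.
- move=> k e.
  rewrite (@psum_ext _ _ (fun n u => grow n u k.+1 e)
    (shx (fun n u => grow_both n u k.+1 (addn e k)))).
    rewrite psum_shx /start_grow INR_addn S_INR.
    have -> : INR e + (INR k + 1) - 1 = INR e + INR k by ring.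
    ring.
  by case=> [|n] u; rewrite ?grow_S ?grow_0.
- move=> k e; rewrite /grow_top_lim grow_top_zS // grow_top_rS //.
  rewrite (@psum_ext _ _ (fun n u => grow_top n u k.+1 e)
    (fun n u => addn (grow n u k.+1 e) (shy (fun n u => addn (grow_top n u k.+2 e) (slide n u k.+2 e)) n u))).
    by rewrite psum_add psum_shy psum_add /start_grow /grow_both_lim /slide_lim /x /y; ring.
  by move=> n [|u]; rewrite ?grow_top_uS ?grow_top_u0 //= addn0.
- move=> k e; rewrite /grow_both_lim grow_both_zS // grow_both_rS //.
  rewrite (@psum_ext _ _ (fun n u => grow_both n u k.+1 e)
    (fun n u => addn (grow_top n u k.+1 e) (shy (fun n u => addn (grow_both n u k.+2 e) (slide_top n u k.+2 e)) n u))).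
    by rewrite psum_add psum_shy psum_add /grow_top_lim /slide_top_lim /x /y; ring.
  by move=> n [|u]; rewrite ?grow_both_uS ?grow_both_u0 //= addn0.
move=> k e; rewrite /start_lim start_zS // start_rS //.
rewrite (@psum_ext _ _ (fun n u => start n u k.+1 e)
  (fun n u => addn (addn (addn (addn (grow n u k.+1 e) (slide n u k.+1 e)) (slide n u k.+1 e))
     (shrink n u k.+1 e)) (shy (fun n u => start n u k.+2 e) n u))).
  by rewrite !psum_add psum_shy /start_grow /grow_both_lim /slide_lim /x /y; ring.
by move=> n [|u]; rewrite ?start_uS ?start_u0 totalE //= addn0.
Qed.

(** The factor [x * y] pays for the first column and the first row, which [start] leaves out; a box
    without columns or rows contributes nothing. *)
Lemma int_sum_series : is_series (hom x y (fun v h => int_sum v h)) (x * y * start_lim 1 0).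
Proof.
have shift v h : int_sum v h = shx (shy (fun n s => start n s 1 0)) v h.
  case: v => [|v]; last case: h => [|h]; last exact: int_sumE.
    rewrite /int_sum big1 // => S /and5P[/set0Pn[[[i ilt] j] _] _ _ _ _]; by [].
  by rewrite /int_sum big1 // => S /and5P[/set0Pn[[i [j jlt]] _] _ _ _ _].
have sumE N : sum_n (hom x y (fun v h => int_sum v h)) N = psum x y (fun v h => int_sum v h) N.+1.
  elim: N => [|N IHN]; first by rewrite sum_O /=; ring.
  by rewrite sum_Sn IHN.
suff h : is_lim_seq (sum_n (hom x y (fun v h => int_sum v h))) (x * y * start_lim 1 0) by exact: h.
apply: (is_lim_seq_ext (fun N => psum x y (fun v h => int_sum v h) N.+1)); first by move=> N; rewrite sumE.
apply/(is_lim_seq_incr_n _ 1).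
apply: (is_lim_seq_ext (fun N => x * (y * psum x y (fun n s => start n s 1 0) N))).
  by move=> N; rewrite Nat.add_1_r (psum_ext _ _ _ shift) psum_shx psum_shy.
rewrite Rmult_assoc; do 2! (apply: (is_lim_seq_scal_l _ _ (Finite _))).
exact: start_cvg.
Qed.
End Convergence.

(** * Evaluation of the limit *)

Section Value.
Variables p w : R.
Let x := p * (1 - w).
Let y := w * (1 - p).
Let s := 1 - p - w.
Hypothesis x_neq1 : 1 - x <> 0.
Hypothesis p_neq1 : 1 - p <> 0.
Hypothesis s_neq0 : s <> 0.

Lemma start_lim_value : let u := y - x - 1 in let D := discr x y in
  x * y * start_lim p w 1 0 =
  8 * x ^ 3 * y ^ 2 * (4 * x * (x ^ 2 + 6 * x - 1) + 4 * x * (5 * x + 11) * u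
                          + (6 * x ^ 2 + 29 * x + 17) * u ^ 2) / D ^ 4
  + x ^ 2 * y ^ 2 * u ^ 3 * (40 * x * (2 * x + 1) + 2 * (x ^ 2 + 11 * x - 8) * u
                                + u ^ 2 * (y + x - 1)) / D ^ 4
  + 4 * x ^ 2 * y ^ 2 * (4 - 3 * (x + y) - (x - y) ^ 2) / s ^ 5.
Proof.
move=> u D.
have dn0 : discr x y <> 0 by rewrite discr_s; apply: pow_nonzero.
rewrite /start_lim (start_z_1 x_neq1 dn0) (start_r_1 p_neq1 s_neq0) /D discr_s.
have := start_num p w; rewrite -/x -/y -/s -/u => num.
(* Since the discriminant is [s ^ 2], the two parts have denominators [4 * s ^ 8] and [s ^ 6]. *)
transitivity (x * y * (start_z_num x y + 4 * p * w * start_r_num p w * s ^ 2) / (4 * s ^ 8)).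
  by field.
by rewrite num; field.
Qed.
End Value.

Lemma kernel_root_exists x y : Rabs x < / 64 -> Rabs y < / 64 ->
  exists p w, [/\ x = p * (1 - w), y = w * (1 - p), Rabs p <= / 8, Rabs w <= / 8
    & sqrt (discr x y) = 1 - p - w].
Proof.
move=> hx hy.
have [x1 x2] := Rabs_def2 _ _ hx; have [y1 y2] := Rabs_def2 _ _ hy.
(* The bounds are the squares of 7/8 and 9/8. *)
have [D1 D2] : 49 / 64 <= discr x y <= 81 / 64 by rewrite /discr; split; nra.
pose s := sqrt (discr x y).
have ss : s * s = discr x y by apply: sqrt_sqrt; lra.
have s0 : 0 <= s by apply: sqrt_pos.
have [s1 s2] : 7 / 8 <= s <= 9 / 8 by split; nra.
(* The solution of [p - w = x - y] and [p + w = 1 - s]. *)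
exists ((1 + x - y - s) / 2), ((1 + y - x - s) / 2); split.
- by move: ss; rewrite /discr; nra.
- by move: ss; rewrite /discr; nra.
- by apply: Rabs_le; lra.
- by apply: Rabs_le; lra.
by rewrite -/s; field.
Qed.

(** [int_sum v h] is the coefficient of [x ^ v * y ^ h] in the derivative at [q = 1]. Grouped by
    total degree, the sums near 0 determine all coefficients. *)
Theorem theorem4p1 :
  exists eps : R, 0 < eps /\
  forall x y : R, Rabs x < eps -> Rabs y < eps ->
  is_series
    (fun N : nat => sum_f_R0 (fun m => INR (int_sum m (N - m)) * x ^ m * y ^ (N - m)) N)
    (let u := y - x - 1 in
     let D := (1 + x - y) ^ 2 - 4 * x in
     8 * x ^ 3 * y ^ 2 * (4 * x * (x ^ 2 + 6 * x - 1) + 4 * x * (5 * x + 11) * u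
                          + (6 * x ^ 2 + 29 * x + 17) * u ^ 2) / D ^ 4
     + x ^ 2 * y ^ 2 * u ^ 3 * (40 * x * (2 * x + 1) + 2 * (x ^ 2 + 11 * x - 8) * u
                                + u ^ 2 * (y + x - 1)) / D ^ 4
     + 4 * x ^ 2 * y ^ 2 * (4 - 3 * (x + y) - (x - y) ^ 2) / (sqrt D) ^ 5).
Proof.
exists (/ 64); split; first lra.
move=> x y hx hy.
have [p [w [xE yE hp hw sE]]] := kernel_root_exists hx hy.
move: (Rlt_le _ _ hx) (Rlt_le _ _ hy) => {}hx {}hy; move: sE hx hy; rewrite {}xE {}yE => sE hx hy.
have h := int_sum_series hp hw hx hy.
rewrite (start_lim_value (x_neq1 hx) (p_neq1 hp) (pw_neq1 hp hw)) -sE in h.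
exact: h.
Qed.
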